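(* Let $F$ be a field of characteristic two and let $(A,\sigma)$ and $(A',\sigma')$ be totally decomposable $F$-algebras with isotropic orthogonal involution, with alternator forms $q_\sigma$ and $q_{\sigma'}$. Then $(A,\sigma)\simeq(A',\sigma')$ as $F$-algebras with involution if and only if $A\simeq A'$ as $F$-algebras and $q_\sigma\simeq q_{\sigma'}$ (isometry).
   Context: $F$ is a field of characteristic two; central simple algebras are finite-dimensional. An involution $\sigma$ on a central simple $F$-algebra $A$ is an anti-automorphism of order two; it is of the first kind if it is the identity on $F$. Put $\mathrm{Alt}(A,\sigma)=\{x-\sigma(x)\mid x\in A\}$. An involution of the first kind is orthogonal if and only if $1\notin\mathrm{Alt}(A,\sigma)$. For $\sigma$ orthogonal, define the alternator subalgebra $S(A,\sigma)=\{x\in A\mid \sigma(x)x\in F\oplus\mathrm{Alt}(A,\sigma)\}$ (it is a unitary $F$-subalgebra of $A$) and, for $x\in S(A,\sigma)$, let $q_\sigma(x)$ be the unique element of $F$ with $\sigma(x)x+q_\sigma(x)\in\mathrm{Alt}(A,\sigma)$; the map $q_\sigma:S(A,\sigma)\to F$ is a totally singular quadratic form (polar form zero), called the alternator form. The involution $\sigma$ is isotropic if $\sigma(x)x=0$ for some nonzero $x\in A$. $(A,\sigma)$ is totally decomposable if $(A,\sigma)\simeq\bigotimes_{i=1}^n(Q_i,\sigma_i)$ with each $Q_i$ a quaternion $F$-algebra (central simple of degree 2) with involution $\sigma_i$. *)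

(* Defs.v *)
From HB Require Import structures.
From mathcomp Require Import all_boot all_order all_algebra all_field.
From mathcomp Require Import boolp classical_sets functions.

Set Implicit Arguments.
Unset Strict Implicit.
Unset Printing Implicit Defensive.

Import GRing.Theory.
Local Open Scope classical_set_scope.
Local Open Scope ring_scope.

(* Two-sided ring ideals of a unital F-algebra are automatically F-subspaces,
   so it is enough to quantify over {vspace A}.  That A is nonzero is part of
   falgType. *)
Definition central_simple (F : fieldType) (A : falgType F) : Prop :=
  'Z({:A})%VS = 1%VS /\
  forall I : {vspace A},
    ({:A} * I <= I)%VS -> (I * {:A} <= I)%VS -> I = 0%VS \/ I = {:A}%VS.

Definition quaternion_algebra (F : fieldType) (Q : falgType F) : Prop :=
  central_simple Q /\ \dim {:Q} = (2 ^ 2)%N.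

Definition involution (R : nzRingType) (s : R -> R) : Prop :=
  [/\ {morph s : x y / x + y}, forall x y, s (x * y) = s y * s x
    & involutive s].

Definition first_kind (F : fieldType) (A : falgType F) (s : A -> A) : Prop :=
  forall a : F, s a%:A = a%:A.

Definition Alt (R : nzRingType) (s : R -> R) : set R :=
  [set x - s x | x in [set: R]].

(* This notion of orthogonality is specific to characteristic two. *)
Definition orthogonal_involution (F : fieldType) (A : falgType F)
    (s : A -> A) : Prop :=
  [/\ involution s, first_kind s & ~ Alt s 1].

Definition isotropic (R : nzRingType) (s : R -> R) : Prop :=
  exists2 x : R, x != 0 & s x * x = 0.

Definition alternator_subalgebra (F : fieldType) (A : falgType F)
    (s : A -> A) : set A :=
  [set x | exists (a : F) (w : A), Alt s w /\ s x * x = a%:A + w].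

(* On the alternator subalgebra of an orthogonal involution there is exactly one
   such scalar in characteristic two; the default value 0 is then not used. *)
Definition alternator_form (F : fieldType) (A : falgType F)
    (s : A -> A) (x : A) : F :=
  xget 0 [set a : F | Alt s (s x * x + a%:A)].

(* S and S' are meant to be subspaces, with quadratic forms q on S and q' on S';
   the values of q, q' and of the map g outside S, S' play no role. *)
Definition isometric (F : fieldType) (V V' : lmodType F)
    (S : set V) (q : V -> F) (S' : set V') (q' : V' -> F) : Prop :=
  exists g : V -> V',
    [/\ set_bij S S' g,
        forall (a : F) (x y : V), S x -> S y -> g (a *: x + y) = a *: g x + g y
      & forall x : V, S x -> q' (g x) = q x].

Definition multilinear (F : fieldType) (n : nat) (V : 'I_n -> lmodType F)
    (W : lmodType F) (t : (forall i, V i) -> W) : Prop :=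
  forall (x : forall i, V i) (i : 'I_n) (a : F) (u v : V i),
    t (dfwith x (a *: u + v)) = a *: t (dfwith x u) + t (dfwith x v).

(* The universal property of the tensor product, t being the map
   (x_i)_i |-> x_1 (x) ... (x) x_n. *)
Definition is_tensor_product (F : fieldType) (n : nat) (V : 'I_n -> lmodType F)
    (T : lmodType F) (t : (forall i, V i) -> T) : Prop :=
  multilinear t /\
  forall (W : lmodType F) (g : (forall i, V i) -> W), multilinear g ->
    (exists h : {linear T -> W}, forall x, h (t x) = g x) /\
    (forall h h' : {linear T -> W},
       (forall x, h (t x) = h' (t x)) -> h =1 h').

(* The product and the involution of A are those of (x)_i (Q i, sQ i): they are
   determined by their values on pure tensors. *)
Definition is_tensor_product_inv (F : fieldType) (n : nat)
    (Q : 'I_n -> falgType F) (sQ : forall i, Q i -> Q i)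
    (A : falgType F) (s : A -> A) (t : (forall i, Q i) -> A) : Prop :=
  [/\ is_tensor_product (V := fun i => Q i : lmodType F) t,
      t (fun i => 1) = 1,
      forall x y, t (fun i => x i * y i) = t x * t y
    & forall x, s (t x) = t (fun i => sQ i (x i))].

Definition totally_decomposable (F : fieldType) (A : falgType F)
    (s : A -> A) : Prop :=
  exists (n : nat) (Q : 'I_n -> falgType F) (sQ : forall i, Q i -> Q i)
         (t : (forall i, Q i) -> A),
    (forall i, quaternion_algebra (Q i) /\ involution (sQ i)) /\
    is_tensor_product_inv sQ s t.

Definition alg_isomorphic (F : fieldType) (A A' : falgType F) : Prop :=
  exists f : {lrmorphism A -> A'}, bijective f.

Definition inv_isomorphic (F : fieldType) (A A' : falgType F)
    (s : A -> A) (s' : A' -> A') : Prop :=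
  exists f : {lrmorphism A -> A'},
    bijective f /\ forall x, f (s x) = s' (f x).

(* Main.v *)
Require Import Defs.
From HB Require Import structures.
From mathcomp Require Import all_boot all_order all_algebra all_field.
From mathcomp Require Import boolp classical_sets functions zify ring.

Import fintype boot.finset.
Import GRing.Theory.
Local Open Scope ring_scope.

(* A is generated by symmetric elements v_j, u_j, one pair for each quaternion
   factor, with v_j^2 = a_j, u_j^2 = u_j + b_j and v_j u_j = (u_j + 1) v_j.  The v_j
   generate a commutative algebra Phi of symmetric elements with scalar squares, and
   the values of the alternator form are exactly the x^2 with x in Phi.  If psi in the
   algebra of the v_i, i <> j, has psi^2 = a_j, then v_j can be replaced by
   v_j psi / a_j, of square 1.  So one may assume a_j = 1 and b_j = 0 for j outside
   a set I such that K = F[v_j | j in I] is a field; if s is isotropic then some k is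
   outside I.
     If the alternator forms are isometric, then K and K' have the same squares and
   are thus isomorphic.  Since A has no proper nonzero right ideal stable under the
   subalgebra generated by K and the v_k, u_k with k outside I, every nonzero
   intertwiner between two embeddings of this subalgebra is invertible, so after an
   inner automorphism both involutions agree on it.  They then differ by Int(g) with
   g in K.  As 1 is not alternating, g can be scaled to the form 1 + z + s(z), and
   a split pair v_k, u_k gives an explicit X with s(X) g X = 1: a metabolic hermitian
   form sees g only modulo alternating elements. *)

Set Implicit Arguments.
Unset Strict Implicit.
Unset Printing Implicit Defensive.

(** * Deciding identities in algebras of characteristic two *)

Inductive sexp := SVar of nat | SOne | SAdd of sexp & sexp | SMul of sexp & sexp.

Inductive aexp := AVar of nat | AZero | AOne | AAdd of aexp & aexp
  | AMul of aexp & aexp | AOpp of aexp | AScale of sexp & aexp.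

Fixpoint snorm (e : sexp) : seq (seq nat) :=
  match e with
  | SVar i => [:: [:: i]]
  | SOne => [:: [::]]
  | SAdd e1 e2 => snorm e1 ++ snorm e2
  | SMul e1 e2 => [seq sort leq (x ++ y) | x <- snorm e1, y <- snorm e2]
  end.

(* A commutative word in the scalars and a word in the algebra. *)
Definition mono := (seq nat * seq nat)%type.

Definition monoM (x y : mono) : mono := (sort leq (x.1 ++ y.1), x.2 ++ y.2).

Definition polyM (p q : seq mono) : seq mono := [seq monoM x y | x <- p, y <- q].

Fixpoint anorm (e : aexp) : seq mono :=
  match e with
  | AVar i => [:: ([::], [:: i])]
  | AZero => [::]
  | AOne => [:: ([::], [::])]
  | AAdd e1 e2 => anorm e1 ++ anorm e2
  | AMul e1 e2 => polyM (anorm e1) (anorm e2)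
  | AOpp e1 => anorm e1
  | AScale c e1 => polyM [seq (x, [::]) | x <- snorm c] (anorm e1)
  end.

Definition rule := (seq nat * aexp)%type.

Fixpoint rewrite_word (l p : seq nat) (r : seq mono) (w : seq nat) :
    option (seq mono) :=
  if prefix l w then
    Some (polyM (polyM [:: ([::], rev p)] r) [:: ([::], drop (size l) w)])
  else if w is x :: w' then rewrite_word l (x :: p) r w' else None.

Fixpoint rewrite_mono (rs : seq rule) (m : mono) : seq mono :=
  if rs is (l, e) :: rs' then
    if rewrite_word l [::] (anorm e) m.2 is Some p then polyM [:: (m.1, [::])] p
    else rewrite_mono rs' m
  else [:: m].

Definition reduce (p : seq mono) : seq mono :=
  [seq x <- undup p | odd (count_mem x p)].

(** [k] bounds the number of passes, each applying at most one rule to a monomial. Only soundness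
    matters: neither termination nor confluence of the rules is claimed. *)
Fixpoint normalize (k : nat) (rs : seq rule) (p : seq mono) : seq mono :=
  if k is k'.+1 then
    normalize k' rs (reduce (flatten [seq rewrite_mono rs m | m <- reduce p]))
  else p.

Section CharTwo.

Variables (F : fieldType) (A : falgType F).
Hypothesis charF2 : 2%N \in [pchar F].

Lemma pcharA2 : 2%N \in [pchar A].
Proof. by rewrite (pchar_lalg A). Qed.

Lemma addxx2 (x : A) : x + x = 0.
Proof. exact: (addrr_pchar2 pcharA2). Qed.

Lemma oppx2 (x : A) : - x = x.
Proof. exact: (oppr_pchar2 pcharA2). Qed.

Variables (es : seq F) (ea : seq A).

Fixpoint seval (e : sexp) : F :=
  match e with
  | SVar i => es`_i
  | SOne => 1
  | SAdd e1 e2 => seval e1 + seval e2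
  | SMul e1 e2 => seval e1 * seval e2
  end.

Fixpoint aeval (e : aexp) : A :=
  match e with
  | AVar i => ea`_i
  | AZero => 0
  | AOne => 1
  | AAdd e1 e2 => aeval e1 + aeval e2
  | AMul e1 e2 => aeval e1 * aeval e2
  | AOpp e1 => - aeval e1
  | AScale c e1 => seval c *: aeval e1
  end.

Let sprod (s : seq nat) : F := \prod_(i <- s) es`_i.
Let aprod (s : seq nat) : A := \prod_(i <- s) ea`_i.
Definition meval (m : mono) : A := sprod m.1 *: aprod m.2.
Definition peval (p : seq mono) : A := \sum_(m <- p) meval m.

Lemma peval_cat p q : peval (p ++ q) = peval p + peval q.
Proof. by rewrite /peval big_cat. Qed.

Lemma monoM_eval x y : meval (monoM x y) = meval x * meval y.
Proof.
rewrite /meval /= /sprod /aprod (perm_big (x.1 ++ y.1)) ?perm_sort //.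
by rewrite !big_cat /= -scalerAl -scalerAr scalerA.
Qed.

Lemma polyM_eval p q : peval (polyM p q) = peval p * peval q.
Proof.
rewrite /polyM /peval big_allpairs_dep /= mulr_suml; apply: eq_bigr => x _.
by rewrite mulr_sumr; apply: eq_bigr => y _; rewrite monoM_eval.
Qed.

Lemma peval1 m : peval [:: m] = meval m.
Proof. by rewrite /peval big_seq1. Qed.

Lemma snorm_eval e : \sum_(s <- snorm e) sprod s = seval e.
Proof.
elim: e => [i||e1 h1 e2 h2|e1 h1 e2 h2] /=.
- by rewrite /sprod !big_seq1.
- by rewrite /sprod big_seq1 big_nil.
- by rewrite big_cat h1 h2.
rewrite big_allpairs_dep /= -h1 -h2 mulr_suml; apply: eq_bigr => x _.
rewrite mulr_sumr; apply: eq_bigr => y _.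
by rewrite /sprod (perm_big (x ++ y)) ?perm_sort // big_cat.
Qed.

Lemma anorm_eval e : peval (anorm e) = aeval e.
Proof.
elim: e => [i|||e1 h1 e2 h2|e1 h1 e2 h2|e1 h1|c e1 h1] /=.
- by rewrite peval1 /meval /sprod /aprod big_nil big_seq1 scale1r.
- by rewrite /peval big_nil.
- by rewrite peval1 /meval /sprod /aprod !big_nil scale1r.
- by rewrite peval_cat h1 h2.
- by rewrite polyM_eval h1 h2.
- by rewrite h1 oppx2.
rewrite polyM_eval h1 -snorm_eval /peval big_map scaler_suml mulr_suml.
apply: eq_bigr => s _.
by rewrite /meval /= /aprod big_nil -scalerAl mul1r.
Qed.

Definition rule_holds (r : rule) : Prop := aprod r.1 = aeval r.2.

Lemma rewrite_word_eval l p r w q : peval r = aprod l ->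
  rewrite_word l p r w = Some q -> peval q = aprod (rev p ++ w).
Proof.
move=> hr; have prefix_eval v p' : prefix l v ->
    peval (polyM (polyM [:: ([::], rev p')] r) [:: ([::], drop (size l) v)]) =
    aprod (rev p' ++ v).
  move=> /prefixP[w' ->]; rewrite drop_size_cat // !polyM_eval !peval1 hr.
  by rewrite /meval /= /sprod big_nil !scale1r /aprod !big_cat /= mulrA.
elim: w p => [|x w IH] p; rewrite /rewrite_word -/rewrite_word;
  case: ifP => hl; try by move=> /Some_inj <-; apply: prefix_eval.
  by [].
by move/IH => ->; rewrite rev_cons cat_rcons.
Qed.

Fixpoint rules_hold (rs : seq rule) : Prop :=
  if rs is r :: rs' then rule_holds r /\ rules_hold rs' else True.

Lemma rewrite_mono_eval rs m : rules_hold rs -> peval (rewrite_mono rs m) = meval m.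
Proof.
elim: rs => [|[l e] rs IH] /=; first by rewrite peval1.
case=> hr /IH h; case E: (rewrite_word _ _ _ _) => [p|] //.
rewrite polyM_eval peval1 (rewrite_word_eval _ E) ?anorm_eval //=.
by rewrite /meval /aprod big_nil -scalerAl mul1r.
Qed.

Lemma reduce_eval p : peval (reduce p) = peval p.
Proof.
rewrite /reduce /peval big_filter -[RHS]big_undup_iterop_count big_mkcond.
apply: eq_bigr => x _; rewrite Monoid.iteropE.
have ->: iter (count_mem x p) (+%R (meval x)) 0 = meval x *+ count_mem x p.
  by elim: (count_mem _ _) => //= n ->; rewrite mulrS.
rewrite -[in RHS](odd_double_half (count_mem x p)) -muln2 mulnC mulrnDr mulrnA.
by rewrite [_ *+ 2]addxx2 mul0rn addr0; case: odd.
Qed.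

Lemma normalize_eval k rs p : rules_hold rs -> peval (normalize k rs p) = peval p.
Proof.
move=> hrs; elim: k p => //= k IH p; rewrite IH reduce_eval -[RHS]reduce_eval.
elim: (reduce p) => //= m q h; rewrite peval_cat h rewrite_mono_eval //.
by rewrite /peval big_cons.
Qed.

Lemma char2_eq k rs e1 e2 : rules_hold rs ->
  normalize k rs (anorm (AAdd e1 e2)) = [::] -> aeval e1 = aeval e2.
Proof.
move=> hrs h; have: aeval (AAdd e1 e2) = 0.
  by rewrite -anorm_eval -(normalize_eval k _ hrs) h /peval big_nil.
by move=> /= /eqP; rewrite addr_eq0 oppx2 => /eqP.
Qed.

Lemma rule_intro l e x y : x = y -> aprod l = x -> aeval e = y ->
  rule_holds (l, e).
Proof. by rewrite /rule_holds /= => -> -> ->. Qed.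

End CharTwo.

Ltac c2_lookup x env :=
  lazymatch env with
  | @nil ?T => constr:((0%N, @cons T x (@nil T)))
  | @cons ?T ?y ?t =>
      let b := match goal with
        | _ => let _ := match goal with _ => constr_eq x y end in constr:(true)
        | _ => constr:(false) end in
      lazymatch b with
      | true => constr:((0%N, env))
      | false => let r := c2_lookup x t in
                 lazymatch r with (?n, ?t') => constr:((S n, @cons T y t')) end
      end
  end.

Ltac c2_sreify e es :=
  lazymatch e with
  | @GRing.one _ => constr:((SOne, es))
  | @GRing.add _ ?x ?y =>
      let r := c2_sreify x es in lazymatch r with (?x', ?es1) =>
      let r := c2_sreify y es1 in lazymatch r with (?y', ?es2) =>
      constr:((SAdd x' y', es2)) end end
  | @GRing.mul _ ?x ?y =>
      let r := c2_sreify x es in lazymatch r with (?x', ?es1) =>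
      let r := c2_sreify y es1 in lazymatch r with (?y', ?es2) =>
      constr:((SMul x' y', es2)) end end
  | _ => let r := c2_lookup e es in lazymatch r with (?n, ?es1) =>
         constr:((SVar n, es1)) end
  end.

Ltac c2_reify e es ea :=
  lazymatch e with
  | @GRing.zero _ => constr:((AZero, es, ea))
  | @GRing.one _ => constr:((AOne, es, ea))
  | @GRing.add _ ?x ?y =>
      let r := c2_reify x es ea in lazymatch r with (?x', ?es1, ?ea1) =>
      let r := c2_reify y es1 ea1 in lazymatch r with (?y', ?es2, ?ea2) =>
      constr:((AAdd x' y', es2, ea2)) end end
  | @GRing.mul _ ?x ?y =>
      let r := c2_reify x es ea in lazymatch r with (?x', ?es1, ?ea1) =>
      let r := c2_reify y es1 ea1 in lazymatch r with (?y', ?es2, ?ea2) =>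
      constr:((AMul x' y', es2, ea2)) end end
  | @GRing.opp _ ?x =>
      let r := c2_reify x es ea in lazymatch r with (?x', ?es1, ?ea1) =>
      constr:((AOpp x', es1, ea1)) end
  | @GRing.scale _ _ ?c ?x =>
      let r := c2_sreify c es in lazymatch r with (?c', ?es1) =>
      let r := c2_reify x es1 ea in lazymatch r with (?x', ?es2, ?ea2) =>
      constr:((AScale c' x', es2, ea2)) end end
  | _ => let r := c2_lookup e ea in lazymatch r with (?n, ?ea1) =>
         constr:((AVar n, es, ea1)) end
  end.

Ltac c2_word e :=
  lazymatch e with
  | AMul ?x ?y => let x' := c2_word x in let y' := c2_word y in
                  let r := eval cbv [cat] in (x' ++ y') in r
  | AVar ?n => constr:([:: n])
  end.

(** The tuple is read from its right end, so the last hypothesis has priority. Unfolding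
    [GRing.comm] lets a commutation hypothesis act as a rule that swaps two letters. *)
Ltac c2_rules hs es ea :=
  lazymatch hs with
  | tt => constr:((@nil rule, es, ea))
  | (?hs', ?h) =>
      let T := type of h in
      let T := eval cbv beta delta [GRing.comm] in T in
      lazymatch T with ?l = ?r =>
      let q := c2_reify l es ea in lazymatch q with (?l', ?es1, ?ea1) =>
      let q := c2_reify r es1 ea1 in lazymatch q with (?r', ?es2, ?ea2) =>
      let w := c2_word l' in
      let q := c2_rules hs' es2 ea2 in lazymatch q with (?rs, ?es3, ?ea3) =>
      constr:(((w, r') :: rs, es3, ea3)) end end end end
  end.

Ltac c2_rules_proof hs :=
  lazymatch hs with
  | tt => exact I
  | (?hs', ?h) => split; [refine (rule_intro h _ _);
      [rewrite /= !big_cons big_nil mulr1 /= ?mulrA; reflexivity | reflexivity]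
      | c2_rules_proof hs']
  end.

(* [c2_with A charF2 (tt, h1, .., hn)] proves an equality in [A] by expanding
   both sides, rewriting words from left to right with the [hi] and cancelling
   in pairs. *)
Ltac c2_with A chF hs :=
  lazymatch goal with |- @eq ?T ?l ?r =>
  let FF := lazymatch type of chF with context [@GRing.pchar ?X] => X end in
  let q := c2_reify l (@nil (GRing.PzSemiRing.sort FF)) (@nil T) in
  lazymatch q with (?l', ?es1, ?ea1) =>
  let q := c2_reify r es1 ea1 in lazymatch q with (?r', ?es2, ?ea2) =>
  let q := c2_rules hs es2 ea2 in lazymatch q with (?rs, ?es3, ?ea3) =>
  refine (@char2_eq FF A chF es3 ea3 64 rs l' r' _ _);
  [c2_rules_proof hs | vm_compute; reflexivity] end end end end.

(** * Orthogonal involutions on quaternion algebras *)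

Lemma linear_pack (F : fieldType) (V W : lmodType F) (f : V -> W) :
  (forall a x y, f (a *: x + y) = a *: f x + f y) ->
  exists h : {linear V -> W}, forall x, h x = f x.
Proof.
move=> hf.
by exists (HB.pack_for {linear V -> W} f (GRing.isLinear.Build F V W _ f hf)).
Qed.

Section CentralSimple.

Variables (F : fieldType) (A : falgType F).
Hypothesis csA : central_simple A.

Lemma central_scalar (z : A) : (forall x, z * x = x * z) -> exists c, z = c%:A.
Proof.
move=> h; suff: z \in 1%VS by case/vlineP=> c ->; exists c.
rewrite -csA.1 memv_cap memvf /=.
by apply/centvP => x _; apply: h.
Qed.

(** The two-sided ideal [I] generated by [n] satisfies [I * I = 0], so it is not all of [A], and
    simplicity leaves only [I = 0]. *)
Lemma central_simple_prime (n : A) : (forall x, n * x * n = 0) -> n = 0.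
Proof.
move=> h; have nAn : (<[n]> * {:A} * <[n]> = 0)%VS.
  have hl : (<[n]> * {:A} <= lker (amulr n))%VS.
    apply/prodvP => x a /vlineP[k ->] _.
    by rewrite memv_ker lfunE /= -!scalerAl h scaler0.
  apply/eqP; rewrite -subv0; apply/prodvP => x y /(subvP hl).
  rewrite memv_ker lfunE /= => /eqP hx /vlineP[k ->].
  by rewrite -scalerAr hx scaler0 mem0v.
set I := ({:A} * <[n]> * {:A})%VS.
have nI : n \in I by rewrite -[n]mulr1 -[n]mul1r !memv_mul ?memvf ?memv_line.
have AA : ({:A} * {:A} = {:A})%VS := prodv_id {:A}%AS.
have II : (I * I = 0)%VS.
  rewrite /I -!prodvA [({:A} * ({:A} * _))%VS]prodvA AA.
  have -> : ({:A} * (<[n]> * ({:A} * (<[n]> * {:A}))) =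
    {:A} * ((<[n]> * {:A} * <[n]>) * {:A}))%VS by rewrite !prodvA.
  by rewrite nAn prod0v prodv0.
case: (csA.2 I).
- by rewrite /I !prodvA AA.
- by rewrite /I -!prodvA AA.
- by move=> I0; apply/eqP; rewrite -memv0 -I0.
move=> IA; have /eqP : (I * I = I)%VS by rewrite IA AA.
by rewrite II => /eqP I0; apply/eqP; rewrite -memv0 I0.
Qed.

End CentralSimple.

Section Quaternion.

Variables (F : fieldType) (Q : falgType F) (rho : Q -> Q).
Hypothesis charF2 : 2%N \in [pchar F].
Hypothesis quatQ : quaternion_algebra Q.

Let csQ := quatQ.1.
Let dimQ : \dim {:Q} = 4%N := quatQ.2.
Let ad (x : Q) : 'End(Q) := amulr x - amull x.

Let adE x y : ad x y = y * x + x * y.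
Proof. by rewrite /ad !lfunE /= !lfunE /= lfunE /= (oppx2 charF2). Qed.

Let dim_cent_ad (x : Q) : (\dim 'C[x] + \dim (limg (ad x)) = 4)%N.
Proof. by rewrite -dimQ -(limg_ker_dim (ad x) {:Q}) capfv. Qed.

Let cent_full (x : Q) : \dim 'C[x]%VS = 4%N -> exists c, x = c%:A.
Proof.
move=> h; apply: (central_scalar csQ) => y; apply/esym/cent1vP.
suff -> : 'C[x]%VS = {:Q}%VS by exact: memvf.
by apply/eqP; rewrite eqEdim subvf h dimQ.
Qed.

Lemma dim1_line (V : {vspace Q}) w : w \in V -> w != 0 -> \dim V = 1%N ->
  V = <[w]>%VS.
Proof.
move=> wV w0 dV; apply/esym/eqP; rewrite eqEdim dV dim_vline w0 andbT.
by rewrite -memvE.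
Qed.

(* If [1, x, x^2] were independent, the centralizer of [x] would be their span
   and the image of [ad x] a line, on which [x] acts by scalars from each side. *)
Lemma quaternion_quadratic (x : Q) : exists t n, x * x = t *: x + n%:A.
Proof.
have [|hxx] := boolP (x * x \in (<[x]> + <[1]>)%VS).
  by case/memv_addP=> _ /vlineP[t ->] [_ /vlineP[n ->] ->]; exists t, n.
have [/vlineP[c hc]|hx] := boolP (x \in <[1]>%VS).
  exists c, 0; by rewrite scale0r addr0 {1}hc -scalerAl mul1r.
have fr : free [:: x * x; x; 1].
  rewrite free_cons span_cons span_seq1 hxx free_cons span_seq1 hx.
  by rewrite /free span_seq1 dim_vline oner_eq0.
pose U := <<[:: (x * x)%R; x; 1%R]>>%VS.
have dU : \dim U = 3%N by apply/eqP.
have UC (z : Q) : z \in 'C[x]%VS -> z \in 'C[(x * x)%R]%VS -> (U <= 'C[z])%VS.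
  move=> h1 h2; apply/span_subvP => y; rewrite !inE => /or3P[] /eqP-> //.
  - by rewrite cent1vC.
  - by rewrite cent1vC.
  exact: cent1v1.
have xC : x \in 'C[x]%VS := cent1v_id x.
have xxC : x \in 'C[(x * x)%R]%VS by apply/cent1vP; rewrite mulrA.
have sUC := UC _ xC xxC.
have dC : \dim 'C[x]%VS = 3%N.
  have := dimvS sUC; rewrite dU leq_eqVlt => /orP[/eqP //|h].
  have /cent_full[c hc] : \dim 'C[x]%VS = 4%N.
    apply/eqP; rewrite eqn_leq h andbT -dimQ; exact: dimvS (subvf _).
  by case/negP: hx; rewrite hc memvZ // memv_line.
have CU : 'C[x]%VS = U by apply/esym/eqP; rewrite eqEdim sUC dC dU.
have d1 : \dim (limg (ad x)) = 1%N.
  by have := dim_cent_ad x; rewrite dC addSn; case.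
have [y hy] : exists y, ad x y != 0.
  apply/not_existsP => h; move: hx; apply/negP; rewrite negbK.
  have [c ->] : exists c, x = c%:A; last by rewrite memvZ // memv_line.
  apply: (central_scalar csQ) => y; apply/eqP.
  rewrite eq_sym -subr_eq0 (oppx2 charF2) -adE.
  by apply/negP => /negP /h.
have hL : limg (ad x) = <[ad x y]>%VS by apply: dim1_line; rewrite ?memv_img ?memvf.
have im z : exists c, ad x z = c *: ad x y.
  by apply/vlineP; rewrite -hL memv_img ?memvf.
have [l hl] := im (x * y); have [m hm] := im (y * x).
(* Left and right multiplication by [x] scale the commutator of [x] and [y] by [l] and [m], so
   [x * x + (l + m) *: x] commutes with [y]. It also commutes with ['C[x]], and [Q] is the sum of
   ['C[x]] and the line of [y]; hence it is central. *)
exists (l + m).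
have hw : y * (x * x + (l + m) *: x) = (x * x + (l + m) *: x) * y.
  move: hl hm; rewrite !adE => hl hm.
  have: x * y * x + x * (x * y) + (y * x * x + x * (y * x)) =
    l *: (y * x + x * y) + m *: (y * x + x * y) by rewrite hl hm.
  move=> h; have: y * (x * x + (l + m) *: x) + (x * x + (l + m) *: x) * y = 0.
    transitivity (x * y * x + x * (x * y) + (y * x * x + x * (y * x)) +
      (l *: (y * x + x * y) + m *: (y * x + x * y))).
      by c2_with Q charF2 tt.
    by rewrite h (addxx2 charF2).
  by move/eqP; rewrite addr_eq0 (oppx2 charF2) => /eqP.
have [q|c hc] := central_scalar csQ (z := x * x + (l + m) *: x).
  have [c hc] := im q.
  have : q + c *: y \in U.
    rewrite -CU cent1vC; apply/cent1vP/eqP; rewrite eq_sym -subr_eq0 (oppx2 charF2) -adE.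
    by rewrite linearD linearZ /= hc (addxx2 charF2).
  move/(subvP (UC (x * x + (l + m) *: x) _ _)) => h.
  have /cent1vP h1 : q + c *: y \in 'C[(x * x + (l + m) *: x)%R]%VS.
    by apply: h; rewrite memvD ?memvZ // ?cent1v_id //; apply/cent1vP; rewrite mulrA.
  have -> : q = (q + c *: y) + c *: y by c2_with Q charF2 tt.
  move: h1 hw; set z := x * x + _ => h1 hw.
  by rewrite [z * _]mulrDr [_ * z]mulrDl h1 -scalerAl -scalerAr hw.
exists c; rewrite -hc; by c2_with Q charF2 tt.
Qed.

Hypothesis rho_inv : involution rho.
Hypothesis rhoZ : forall c x, rho (c *: x) = c *: rho x.
Hypothesis alt1 : ~ Alt rho 1.

(** The map [x + rho x] squares to zero and [1] lies in its kernel but not in its image, so its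
    image is at most a line; [v] spans it. Then ['C[v]] has dimension two and equals the image of
    [ad v], which therefore contains [v] and provides [u]. *)
Lemma quaternion_orthogonal_generators : exists (v u : Q) (a b : F),
  [/\ a != 0, v * v = a%:A, u * u = u + b%:A, v * u = u * v + v &
    [/\ rho v = v, rho u = u & forall x, exists c1 c2 c3 c4 : F,
      x = c1%:A + c2 *: v + c3 *: u + c4 *: (v * u)]].
Proof.
have [rhoD rhoM rhoK] := rho_inv.
have rho1 : rho 1 = 1 by have := rhoM 1 (rho 1); rewrite mul1r rhoK mul1r.
have [d hd] : exists h : {linear Q -> Q}, forall x, h x = x + rho x.
  by apply: linear_pack => c x y; rewrite rhoD rhoZ scalerDr addrACA.
pose D := linfun d; have DE x : D x = x + rho x by rewrite lfunE hd.
have n1 : 1 \notin limg D.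
  apply/negP => /memv_imgP[x _ hx]; apply: alt1; exists x => //.
  by rewrite hx DE (oppx2 charF2).
have sD : (limg D <= lker D)%VS.
  apply/subvP => _ /memv_imgP[x _ ->]; rewrite memv_ker !DE rhoD rhoK.
  by rewrite addrC [X in X + _]addrC addrC (addxx2 charF2).
have k1 : 1 \in lker D by rewrite memv_ker DE rho1 (addxx2 charF2).
have d1 : (\dim (limg D) <= 1)%N.
  have lt : (\dim (limg D) < \dim (lker D))%N.
    rewrite ltnNge; apply/negP => h; case/negP: n1.
    suff -> : limg D = lker D by [].
    by apply/eqP; rewrite eqEdim sD h.
  have := limg_ker_dim D {:Q}; rewrite capfv dimQ => h.
  by move: lt h; set k := \dim (lker D); set l := \dim (limg D); lia.
have [x0 hx0] : exists x, x + rho x != 0.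
  apply/not_existsP => h.
  have hr x : rho x = x.
    have /negP := h x; rewrite negbK addr_eq0 (oppx2 charF2) eq_sym.
    by move/eqP.
  have : ({:Q} <= 1)%VS.
    apply/subvP => x _; have [y|c ->] := central_scalar csQ (z := x).
      by rewrite -[x * y]hr rhoM !hr.
    by rewrite memvZ // memv_line.
  by move/dimvS; rewrite dimQ dimv1.
have [v vE] : exists v, v = x0 + rho x0 by exists (x0 + rho x0).
have alt q : exists l, q + rho q = l *: v.
  have vD : v \in limg D by rewrite vE -DE memv_img ?memvf.
  suff dD : \dim (limg D) = 1%N.
    by apply/vlineP; rewrite -(dim1_line vD) ?vE // -DE memv_img ?memvf.
  apply/eqP; rewrite eqn_leq d1 lt0n dimv_eq0; apply/negP => /eqP h.
  have : D x0 \in limg D by rewrite memv_img ?memvf.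
  by rewrite h memv0 DE (negbTE hx0).
have rv : rho v = v by rewrite vE rhoD rhoK addrC.
have vN c : v <> c%:A.
  move=> hv; have c0 : c != 0.
    by apply: contraNneq hx0 => c0; rewrite -vE hv c0 scale0r.
  apply: alt1; exists (c^-1 *: x0) => //.
  by rewrite rhoZ (oppx2 charF2) -scalerDr -vE hv scalerA mulVf // scale1r.
(* The elements [y] with [y + rho y = v] span [Q], so a property stable under sums and scalar
   multiples need only be checked on them. *)
have ext (T : Q -> Prop) : (forall y, y + rho y = v -> T y) ->
    (forall c y, T y -> T (c *: y)) -> (forall y z, T y -> T z -> T (y + z)) ->
    forall q, T q.
  move=> T1 TZ TD q; have [l hl] := alt q.
  have [l0|l0] := eqVneq l 0.
    have -> : q = (q + x0) + x0 by c2_with Q charF2 tt.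
    apply: TD; apply: T1; rewrite ?vE //.
    by rewrite rhoD addrACA hl l0 scale0r add0r.
  have -> : q = l *: (l^-1 *: q) by rewrite scalerA mulfV // scale1r.
  by apply/TZ/T1; rewrite rhoZ -scalerDr hl scalerA mulVf // scale1r.
(* Applying [rho] to the quadratic equation of [y] shows that [y + v] satisfies it too; subtracting
   gives the relation. *)
have key y : y + rho y = v -> exists t, v * y = y * v + v * v + t *: v.
  move=> hy; have [t [n hn]] := quaternion_quadratic y; exists t.
  have hr : rho y = y + v by rewrite -hy; c2_with Q charF2 tt.
  have : rho (y * y) = rho (t *: y + n%:A) by rewrite hn.
  rewrite rhoM rhoD !rhoZ rho1 hr => h.
  transitivity (y * v + v * v + t *: v + ((y + v) * (y + v) + (t *: (y + v) + n%:A))).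
    by c2_with Q charF2 (tt, hn).
  by rewrite h (addxx2 charF2) addr0.
have [a hv] : exists a, v * v = a%:A.
  have [t [n hn]] := quaternion_quadratic v; exists n.
  have [t0|t0] := eqVneq t 0; first by rewrite hn t0 scale0r add0r.
  suff [c /vN] : exists c, v = c%:A by [].
  apply: (central_scalar csQ); apply: ext => [y /key[ty hy]|c y h|y z hy hz].
  - have h : t *: (v * y + y * v) = 0.
      have -> : t *: (v * y + y * v) = (t *: v + n%:A) * y + y * (t *: v + n%:A).
        by c2_with Q charF2 tt.
      by rewrite -hn; c2_with Q charF2 (tt, hy).
    move/eqP: h; rewrite scaler_eq0 (negbTE t0) addr_eq0 (oppx2 charF2).
    by move/eqP.
  - by rewrite -scalerAr h scalerAl.
  by rewrite mulrDr hy hz mulrDl.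
have a0 : a != 0.
  apply: contraPneq hx0 => a0; rewrite -vE; suff -> : v = 0 by rewrite eqxx.
  apply: (central_simple_prime csQ).
  have vv0 : v * v = 0 by rewrite hv a0 scale0r.
  apply: ext => [y /key[ty hy]|c y h|y z hy hz].
  - by c2_with Q charF2 (tt, hy, vv0).
  - by rewrite -scalerAr -scalerAl h scaler0.
  by rewrite mulrDr mulrDl hy hz addr0.
have limC : (limg (ad v) <= 'C[v])%VS.
  apply/subvP => _ /memv_imgP[x _ ->]; apply/cent1vP; rewrite adE.
  by c2_with Q charF2 (tt, hv).
have dC : \dim 'C[v]%VS = 2%N.
  have sum4 := dim_cent_ad v; have := dimvS limC.
  (* In dimension three the commutators with [v] form a line, on which [v] acts by a scalar [l] with
     [l * l = a]. Then [n = v + l%:A] satisfies [n * q * n = 0] for all [q], which makes [v] a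
     scalar. *)
  have : \dim 'C[v]%VS <> 3%N.
    move=> d3; have [y hy] : exists y, ad v y != 0.
      apply/not_existsP => h.
      have : limg (ad v) = 0%VS.
        apply/eqP; rewrite -subv0; apply/subvP => _ /memv_imgP[x _ ->].
        by rewrite memv0; apply/negP => /negP /h.
      by move=> h0; move: sum4; rewrite d3 h0 dimv0.
    have hL : limg (ad v) = <[ad v y]>%VS.
      apply: dim1_line; rewrite ?memv_img ?memvf //.
      by move: sum4; rewrite d3 addSn; case.
    have im z : exists c, ad v z = c *: ad v y.
      by apply/vlineP; rewrite -hL memv_img ?memvf.
    have [l hl] := im (v * y).
    have vw : v * ad v y = l *: ad v y.
      by rewrite -hl !adE; c2_with Q charF2 (tt, hv).
    have la : l * l = a.
      apply/eqP; rewrite -subr_eq0; apply/eqP.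
      have : (l * l - a) *: ad v y = 0.
        rewrite scalerBl -scalerA -vw scalerAr -vw mulrA hv -scalerAl mul1r.
        by rewrite subrr.
      by move/eqP; rewrite scaler_eq0 (negbTE hy) orbF => /eqP.
    have nn : (v + l%:A) * (v + l%:A) = 0.
      have -> : (v + l%:A) * (v + l%:A) = v * v + (l * l)%:A by c2_with Q charF2 tt.
      by rewrite la hv (addxx2 charF2).
    have nw : (v + l%:A) * ad v y = 0.
      by rewrite mulrDl vw -scalerAl mul1r (addxx2 charF2).
    suff /eqP : v + l%:A = 0.
      by rewrite addr_eq0 (oppx2 charF2) => /eqP /vN.
    apply: (central_simple_prime csQ) => q.
    have [c hc] := im q.
    have -> : (v + l%:A) * q * (v + l%:A) = (v + l%:A) * (v + l%:A) * q +
        (v + l%:A) * ad v q.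
      by rewrite adE; c2_with Q charF2 tt.
    by rewrite nn hc -scalerAr nw scaler0 mul0r addr0.
  have : \dim 'C[v]%VS <> 4%N by move=> /cent_full[c /vN].
  move: sum4; set k := \dim 'C[v]%VS; set l := \dim (limg _); lia.
have CL : limg (ad v) = 'C[v]%VS.
  apply/eqP; rewrite eqEdim limC dC; have := dim_cent_ad v; rewrite dC.
  by set l := \dim (limg _); lia.
have [u hu] : exists u, v * u = u * v + v.
  have : v \in limg (ad v) by rewrite CL cent1v_id.
  case/memv_imgP => u _; rewrite adE => hu; exists u.
  transitivity (u * v + (u * v + v * u)); last by rewrite -hu.
  by c2_with Q charF2 tt.
have [t [b hub]] := quaternion_quadratic u.
have t1 : t = 1.
  have h : (t - 1) *: v = 0.
    have -> : (t - 1) *: v = ((t *: u + b%:A) * v + v * (t *: u + b%:A)) + v.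
      by rewrite scalerBl scale1r; c2_with Q charF2 (tt, hu).
    by rewrite -hub; c2_with Q charF2 (tt, hu).
  move/eqP: h; rewrite scaler_eq0 subr_eq0 => /orP[/eqP //|/eqP h].
  by case: (vN 0); rewrite scale0r.
rewrite t1 scale1r in hub.
(* Otherwise [rho u = u + c *: v] with [c != 0]; since [u * v + rho (u * v)] is a multiple of [v],
   so would be the nonzero scalar [c * a]. *)
have ru : rho u = u.
  have [c hc] := alt u; have [l hl] := alt (u * v).
  have hr : rho u = u + c *: v by rewrite -hc; c2_with Q charF2 tt.
  have h : (c * a)%:A = (l + 1) *: v.
    rewrite scalerDl -hl rhoM rv hr -scalerA -hv.
    by c2_with Q charF2 (tt, hu).
  have ca : c * a = 0.
    have [l1|l1] := eqVneq (l + 1) 0.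
      move/eqP: h; rewrite l1 scale0r scaler_eq0 oner_eq0 orbF.
      by move/eqP.
    case: (vN ((l + 1)^-1 * (c * a))).
    by rewrite -scalerA h scalerA mulVf // scale1r.
  move/eqP: ca; rewrite mulf_eq0 (negbTE a0) orbF => /eqP c0.
  by rewrite hr c0 scale0r addr0.
exists v, u, a, b; split=> //; split=> // q.
have C2 : 'C[v]%VS = <<[:: v; 1%R]>>%VS.
  apply/esym/eqP; rewrite eqEdim dC; apply/andP; split.
    apply/span_subvP => y; rewrite !inE => /orP[] /eqP ->; first exact: cent1v_id.
    exact: cent1v1.
  suff /eqP -> : free [:: v; 1] by [].
  rewrite free_cons span_seq1 /free span_seq1 dim_vline oner_eq0 eqxx andbT.
  by apply/negP => /vlineP[c /vN].
have in2 x : x \in 'C[v]%VS -> exists c1 c2, x = c1%:A + c2 *: v.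
  rewrite C2 span_cons span_seq1 => /memv_addP[_ /vlineP[k1' ->]].
  by case=> _ /vlineP[k2' ->] ->; exists k2', k1'; rewrite addrC.
have [|c1 [c2 h1]] := in2 (ad v q); first by rewrite -CL memv_img ?memvf.
(* The commutators of [v] with [u] and with [v * u] are [v] and [a%:A], so these corrections cancel
   the commutator of [v] with [q]. *)
have [|c3 [c4 h2]] := in2 (q + c2 *: u + (c1 / a) *: (v * u)).
  apply/cent1vP; apply/eqP.
  rewrite -subr_eq0 (oppx2 charF2) -adE !linearD !linearZ /=.
  rewrite h1 !adE.
  have -> : u * v + v * u = v by c2_with Q charF2 (tt, hu).
  have -> : v * u * v + v * (v * u) = a%:A by c2_with Q charF2 (tt, hv, hu).
  by rewrite scalerA divfK //; apply/eqP; c2_with Q charF2 tt.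
exists c3, c4, c2, (c1 / a).
by rewrite -h2; c2_with Q charF2 tt.
Qed.

End Quaternion.

(** * Symmetric generators of totally decomposable algebras *)

(** Generation is encoded by the last field, which says that the centralizer of all [v j] and [u j]
    is [F]; this passes easily to new generators, and actual generation is recovered from it in
    [gen_ind]. *)
Record symmetric_generators (F : fieldType) (A : falgType F) (s : A -> A)
    (J : finType) (v u : J -> A) (a b : J -> F) : Prop := SymmetricGenerators {
  sg_a0 : forall j, a j != 0;
  sg_vv : forall j, v j * v j = (a j)%:A;
  sg_uu : forall j, u j * u j = u j + (b j)%:A;
  sg_vu : forall j, v j * u j = u j * v j + v j;
  sg_vC : forall i j, GRing.comm (v i) (v j);
  sg_uC : forall i j, GRing.comm (u i) (u j);
  sg_vuC : forall i j, i != j -> GRing.comm (v i) (u j);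
  sg_sv : forall j, s (v j) = v j;
  sg_su : forall j, s (u j) = u j;
  sg_cent : forall x, (forall j, GRing.comm x (v j)) ->
    (forall j, GRing.comm x (u j)) -> exists c, x = c%:A }.

Lemma commrZ (F : fieldType) (A : algType F) (x y : A) c :
  GRing.comm x y -> GRing.comm x (c *: y).
Proof. by rewrite /GRing.comm -scalerAr -scalerAl => ->. Qed.

Lemma involution1 (R : nzRingType) (s : R -> R) : involution s -> s 1 = 1.
Proof. by case=> _ sM sK; have := sM 1 (s 1); rewrite mul1r sK mul1r. Qed.

Lemma involutionZ (F : fieldType) (A : falgType F) (s : A -> A) :
  involution s -> first_kind s -> forall c x, s (c *: x) = c *: s x.
Proof.
move=> [_ sM _] s1 c x; rewrite -[c *: x]mulr_algl sM s1 -[s x * _]scalerAr.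
by rewrite mulr1.
Qed.

Section Decomposable.

Variables (F : fieldType) (A : falgType F) (s : A -> A).
Hypothesis charF2 : 2%N \in [pchar F].
Hypothesis csA : central_simple A.
Hypothesis orthA : orthogonal_involution s.

Section Tensor.

Variables (n : nat) (Q : 'I_n -> falgType F) (sQ : forall i, Q i -> Q i).
Variable t : (forall i, Q i) -> A.
Hypothesis quatQ : forall i, quaternion_algebra (Q i) /\ involution (@sQ i).
Hypothesis tensorA : is_tensor_product_inv sQ s t.

Let e i (x : Q i) : A := t (dfwith (fun k => 1 : Q k) x).

Let eE i (x : Q i) (z : forall k, Q k) : z i = x ->
  (forall k, k != i -> z k = 1) -> t z = e x.
Proof.
move=> h1 h2; congr t; apply: functional_extensionality_dep => k.
by case: dfwithP => [//|j hj]; rewrite h2 // eq_sym.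
Qed.

Let e_linear i c (x y : Q i) : e (c *: x + y) = c *: e x + e y.
Proof. by case: tensorA => -[tL _] _ _ _; exact: tL. Qed.

Let e1 i : e (1 : Q i) = 1.
Proof. by case: tensorA => _ <- _ _; rewrite -(@eE _ _ (fun=> 1)). Qed.

Let eM i (x y : Q i) : e (x * y) = e x * e y.
Proof.
case: tensorA => _ _ tM _; rewrite -tM; apply/esym/eE.
  by rewrite !dfwith_in.
by move=> k hk; rewrite !dfwith_out 1?eq_sym ?mul1r // eq_sym.
Qed.

Let eC i j (x : Q i) (y : Q j) : i != j -> GRing.comm (e x) (e y).
Proof.
case: tensorA => _ _ tM _ hij; rewrite /GRing.comm -!tM; congr t.
apply: functional_extensionality_dep => k.
have [hi|hi] := eqVneq i k.
  by rewrite [dfwith _ y _]dfwith_out ?mulr1 ?mul1r // -hi eq_sym.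
by rewrite [dfwith _ x _]dfwith_out ?mulr1 ?mul1r.
Qed.

Let es i (x : Q i) : s (e x) = e (sQ x).
Proof.
case: tensorA => _ _ _ ts; rewrite ts; apply: eE; first by rewrite dfwith_in.
by move=> k hk; rewrite dfwith_out 1?eq_sym // involution1 //; case: (quatQ k).
Qed.

Let e_inj i (x : Q i) : e x = 0 -> x = 0.
Proof.
have [f hf] := linear_pack (@e_linear i); move=> x0.
have [[[_ simQ] _] _] := quatQ i.
have kE y : (y \in lker (linfun f)) = (e y == 0) by rewrite memv_ker lfunE hf.
case: (simQ (lker (linfun f))).
- apply/prodvP => y z _; rewrite !kE eM => /eqP ->; by rewrite mulr0.
- apply/prodvP => y z; rewrite !kE eM => /eqP -> _; by rewrite mul0r.
- by move=> h; apply/eqP; rewrite -memv0 -h kE x0.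
move=> h; have := memvf (1 : Q i); rewrite -h kE e1 => /eqP /eqP.
by rewrite oner_eq0.
Qed.

(** Pure tensors are products of elements of the factors, so the commutator with [x] vanishes on
    them; by the uniqueness part of the universal property it vanishes everywhere. *)
Let e_span x : (forall i (y : Q i), GRing.comm x (e y)) -> forall y, GRing.comm x y.
Proof.
case: tensorA => -[tL tuniv] t1 tM _ hx.
have ht z : GRing.comm x (t z).
  pose zk k i : Q i := if (i < k)%N then z i else 1.
  have -> : z = zk n.
    by apply: functional_extensionality_dep => i; rewrite /zk ltn_ord.
  have : (n <= n)%N by []; elim: {1 3}n => [_|k IH hk].
    by rewrite t1; exact: commr1.
  have -> : zk k.+1 = fun i => zk k i * dfwith (fun j => 1 : Q j) (z (Ordinal hk)) i.
    apply: functional_extensionality_dep => i; rewrite /zk.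
    case: dfwithP => [|j hj]; first by rewrite /= ltnn ltnSn mul1r.
    rewrite mulr1 ltnS leq_eqVlt; case: eqP => //= jk.
    by case/eqP: hj; apply: val_inj.
  by rewrite tM; apply: commrM; [apply: IH; apply: ltnW|exact: hx].
have [h hh] : exists h : {linear A -> A}, forall y, h y = x * y - y * x.
  apply: linear_pack => c y z; rewrite mulrDl mulrDr -scalerAr -scalerAl.
  by rewrite scalerBr opprD addrACA.
have [h0 hh0] : exists h : {linear A -> A}, forall y, h y = 0.
  by apply: linear_pack => c y z; rewrite scaler0 addr0.
have [_ /(_ h h0) H] := tuniv A t tL.
move=> y; have := H _ y; rewrite hh hh0 => E.
apply/eqP; rewrite -subr_eq0; apply/eqP/E => z; rewrite hh hh0.
by apply/eqP; rewrite subr_eq0; apply/eqP/ht.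
Qed.

(** [quaternion_orthogonal_generators] is applied in each factor: the embedding [e] pulls the
    linearity of [s] and the fact that [1] is not alternating back to [sQ i]. *)
Lemma tensor_generators : exists (v u : 'I_n -> A) (a b : 'I_n -> F),
  symmetric_generators s v u a b.
Proof.
have [sinv s1 nalt] := orthA; have sZ := involutionZ sinv s1.
pose P (i : 'I_n) (p : A * A * (F * F)) := exists x y : Q i,
  [/\ p.1 = (e x, e y),
    [/\ p.2.1 != 0, e x * e x = p.2.1%:A,
      e y * e y = e y + p.2.2%:A & e x * e y = e y * e x + e x],
    s (e x) = e x, s (e y) = e y &
    forall z, GRing.comm z (e x) -> GRing.comm z (e y) ->
      forall q : Q i, GRing.comm z (e q)].
have [i|f hf] := @choice _ _ P.
  have [hQ hs] := quatQ i.
  have [f hf] := linear_pack (@e_linear i).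
  have eZ c (x : Q i) : e (c *: x) = c *: e x by rewrite -!hf linearZ.
  have eD (x y : Q i) : e (x + y) = e x + e y by rewrite -!hf linearD.
  have rZ c (x : Q i) : sQ (c *: x) = c *: sQ x.
    apply/eqP; rewrite -subr_eq0 -scaleN1r; apply/eqP/e_inj.
    by rewrite eD !eZ -!es eZ sZ scaleN1r subrr.
  have nr : ~ Alt (@sQ i) 1.
    case=> x _ hx; apply: nalt; exists (e x) => //.
    by rewrite es -scaleN1r -eZ -eD scaleN1r hx e1.
  have [x [y [a [b [a0 h1 h2 h3 [h4 h5 h6]]]]]] :=
    quaternion_orthogonal_generators charF2 hQ hs rZ nr.
  exists (e x, e y, (a, b)), x, y; split => //=.
  - split=> //; first by rewrite -eM h1 eZ e1.
    + by rewrite -eM h2 eD eZ e1.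
    by rewrite -!eM h3 eD.
  - by rewrite es h4.
  - by rewrite es h5.
  move=> z zx zy q; have [c1 [c2 [c3 [c4 ->]]]] := h6 q.
  rewrite !eD !eZ e1 eM.
  by do !apply: commrD; apply: commrZ => //; [exact: commr1|exact: commrM].
exists (fun i => (f i).1.1), (fun i => (f i).1.2), (fun i => (f i).2.1),
  (fun i => (f i).2.2).
split; try by move=> i; have [x [y [e_i [h1 h2 h3 h4] h5 h6 h7]]] := hf i;
  rewrite ?e_i.
- move=> i j; have [->|hij] := eqVneq i j; first exact: commr_refl.
  have [x [y [-> _ _ _ _]]] := hf i; have [x' [y' [-> _ _ _ _]]] := hf j.
  exact: eC.
- move=> i j; have [->|hij] := eqVneq i j; first exact: commr_refl.
  have [x [y [-> _ _ _ _]]] := hf i; have [x' [y' [-> _ _ _ _]]] := hf j.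
  exact: eC.
- move=> i j hij.
  have [x [y [-> _ _ _ _]]] := hf i; have [x' [y' [-> _ _ _ _]]] := hf j.
  exact: eC.
move=> z zv zu; apply: (central_scalar csA); apply: e_span => i q.
have [x [y [h _ _ _ hz]]] := hf i; apply: hz.
- by have := zv i; rewrite h.
by have := zu i; rewrite h.
Qed.

End Tensor.

Lemma decomposable_generators : totally_decomposable s ->
  exists (n : nat) (v u : 'I_n -> A) (a b : 'I_n -> F),
    symmetric_generators s v u a b.
Proof.
by case=> n [Q [sQ [t [hQ ht]]]]; exists n; exact: tensor_generators hQ ht.
Qed.

End Decomposable.

(** * Centralizers of symmetric generators *)

Section Generators.

Variables (F : fieldType) (A : falgType F) (s : A -> A).
Hypothesis charF2 : 2%N \in [pchar F].
Variables (J : finType) (v u : J -> A) (a b : J -> F).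
Hypothesis sg : symmetric_generators s v u a b.

Ltac c2 hs := c2_with A charF2 hs.

Implicit Types (S T : {set J}) (x y : A) (i j : J).

(** Subalgebras are described by what they commute with. For [S = [set: J]] this one is generated by
    the [v j] with [j] outside [T]: [T = set0] gives the commutative algebra Phi and [T = ~: I]
    gives K. For [S = T = set0] it is all of [A]. *)
Definition gen_cent (S T : {set J}) : {vspace A} :=
  ((\bigcap_(j in S) 'C[v j]) :&: (\bigcap_(j in T) 'C[u j]))%VS.

Lemma gen_centP S T x :
  reflect ((forall j, j \in S -> GRing.comm x (v j)) /\
           (forall j, j \in T -> GRing.comm x (u j))) (x \in gen_cent S T).
Proof.
rewrite memv_cap memvE [X in _ && X]memvE; apply: (iffP andP).
  by case=> /subv_bigcapP h1 /subv_bigcapP h2; split=> j hj; apply/cent1vP;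
    [have := h1 j hj|have := h2 j hj]; rewrite -memvE.
by case=> h1 h2; split; apply/subv_bigcapP => j hj; rewrite -memvE;
  apply/cent1vP; [exact: h1|exact: h2].
Qed.

Lemma gen_centS S (S' : {set J}) T (T' : {set J}) x : S \subset S' -> T \subset T' ->
  x \in gen_cent S' T' -> x \in gen_cent S T.
Proof.
move=> /subsetP hS /subsetP hT /gen_centP[h1 h2].
by apply/gen_centP; split=> j hj; [apply/h1/hS|apply/h2/hT].
Qed.

Lemma gen_cent_scalar S T c : c%:A \in gen_cent S T.
Proof.
by apply/gen_centP; split=> j _; apply/commr_sym/commrZ; exact: commr1.
Qed.

Lemma gen_centM S T x y :
  x \in gen_cent S T -> y \in gen_cent S T -> x * y \in gen_cent S T.
Proof.
move=> /gen_centP[h1 h2] /gen_centP[h3 h4].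
by apply/gen_centP; split=> j hj; apply/commr_sym/commrM; apply/commr_sym; auto.
Qed.

Definition vinv j := (a j)^-1 *: v j.

Lemma vinvK j : v j * vinv j = 1.
Proof. by rewrite /vinv -scalerAr (sg_vv sg) scalerA mulVf ?scale1r ?(sg_a0 sg). Qed.

Lemma vKinv j : vinv j * v j = 1.
Proof. by rewrite /vinv -scalerAl (sg_vv sg) scalerA mulVf ?scale1r ?(sg_a0 sg). Qed.

Lemma mulv_eq0 x j : x * v j = 0 -> x = 0.
Proof. by move=> h; rewrite -[x]mulr1 -(vinvK j) mulrA h mul0r. Qed.

Lemma sg_uv j : u j * v j = v j * u j + v j.
Proof. by c2 (tt, sg_vu sg j). Qed.

Lemma vinv_u j : vinv j * u j = u j * vinv j + vinv j.
Proof. by rewrite -scalerAl (sg_vu sg) scalerDr scalerAr. Qed.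

Lemma comm_vinv x j : GRing.comm x (v j) -> GRing.comm x (vinv j).
Proof. exact: commrZ. Qed.

(** The commutator of [v j] with [q * u j] is [q * v j], which dictates [q]; since [v j] has a
    scalar square, every commutator with [v j] commutes with [v j]. *)
Lemma gen_cent_decomp_v S T x j : j \notin S -> j \notin T ->
  x \in gen_cent S T -> exists p q, [/\ p \in gen_cent (j |: S) T,
    q \in gen_cent (j |: S) T & x = p + q * u j].
Proof.
move=> jS jT /gen_centP[hS hT].
pose q := (v j * x + x * v j) * vinv j.
have other c : GRing.comm c (v j) -> GRing.comm c (u j) -> GRing.comm c x ->
    GRing.comm c q /\ GRing.comm c (x + q * u j).
  move=> cv cu cx; have cq : GRing.comm c q.
    by apply: commrM; [apply: commrD; apply: commrM|exact: comm_vinv].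
  by split=> //; apply/commrD/commrM.
have vv := sg_vv sg j; have vw := vinvK j; have wv := vKinv j.
have uv := sg_uv j.
have qv : GRing.comm q (v j).
  have vvx : v j * v j * x = x * (v j * v j) by c2 (tt, vv).
  by rewrite /GRing.comm /q; c2 (tt, vw, wv, vvx).
exists (x + q * u j), q; split; last by c2 tt.
- apply/gen_centP; split=> i; last first.
    move=> iT; apply/commr_sym; have ij : j != i by apply: contraNneq jT => ->.
    apply: (other (u i) _ _ _).2.
    + exact/commr_sym/(sg_vuC sg).
    + exact: sg_uC sg _ _.
    exact/commr_sym/hT.
  rewrite in_setU1 => /orP[/eqP ->|iS].
    have qvq : q * v j = v j * x + x * v j by rewrite -mulrA wv mulr1.
    by rewrite /GRing.comm; c2 (tt, uv, qvq, esym qv).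
  have ij : i != j by apply: contraNneq jS => <-.
  apply/commr_sym; apply: (other (v i) _ _ _).2.
  + exact: sg_vC sg _ _.
  + exact: sg_vuC sg _ _ ij.
  exact/commr_sym/hS.
apply/gen_centP; split=> i; last first.
  move=> iT; apply/commr_sym; have ij : j != i by apply: contraNneq jT => ->.
  apply: (other (u i) _ _ _).1.
  + exact/commr_sym/(sg_vuC sg).
  + exact: sg_uC sg _ _.
  exact/commr_sym/hT.
rewrite in_setU1 => /orP[/eqP -> //|iS].
have ij : i != j by apply: contraNneq jS => <-.
apply/commr_sym; apply: (other (v i) _ _ _).1.
+ exact: sg_vC sg _ _.
+ exact: sg_vuC sg _ _ ij.
exact/commr_sym/hS.
Qed.

Lemma gen_cent_ad S T x j :
  x \in gen_cent S T -> u j * x + x * u j \in gen_cent S T.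
Proof.
move=> /gen_centP[hS hT]; have uv := sg_uv j.
have other c : GRing.comm c (u j) -> GRing.comm c x ->
    GRing.comm c (u j * x + x * u j).
  by move=> cu cx; apply: commrD; apply: commrM.
apply/gen_centP; split=> i hi; last first.
  by apply/commr_sym/other; [exact: sg_uC sg _ _|exact/commr_sym/hT].
have [ij|ij] := eqVneq i j; last first.
  by apply/commr_sym/other; [exact: sg_vuC sg _ _ ij|exact/commr_sym/hS].
have xv : x * v j = v j * x by rewrite -ij; apply: hS.
by rewrite ij /GRing.comm; c2 (tt, xv, uv).
Qed.

Lemma gen_cent_decomp_u S T x j : j \notin T ->
  x \in gen_cent S T -> exists x0 x1, [/\ x0 \in gen_cent S (j |: T),
    x1 \in gen_cent S (j |: T), x = x0 + x1 * v j &
    x1 * v j = u j * x + x * u j].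
Proof.
move=> jT hx; have [hS hT] := gen_centP _ _ _ hx.
pose w := u j * x + x * u j.
have wv := vKinv j; have uu := sg_uu sg j; have wu := vinv_u j.
have wE : w * vinv j * v j = w by rewrite -mulrA wv mulr1.
have [hwS hwT] := gen_centP _ _ _ (gen_cent_ad j hx).
exists (x + w), (w * vinv j); split.
- apply/gen_centP; split=> i hi.
    by apply/commr_sym/commrD; apply/commr_sym; auto.
  move: hi; rewrite in_setU1 => /orP[/eqP ->|iT].
    by rewrite /GRing.comm /w; c2 (tt, uu).
  by apply/commr_sym/commrD; apply/commr_sym; auto.
- apply/gen_centP; split=> i hi.
    apply/commr_sym/commrM; first by apply/commr_sym; auto.
    by apply/comm_vinv; exact: sg_vC sg _ _.
  move: hi; rewrite in_setU1 => /orP[/eqP ->|iT].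
    by rewrite /GRing.comm /w; c2 (tt, uu, wu).
  have ij : j != i by apply: contraNneq jT => ->.
  apply/commr_sym/commrM; first by apply/commr_sym; auto.
  by apply/comm_vinv/commr_sym; exact: sg_vuC sg _ _ ij.
- by rewrite wE; c2 tt.
by [].
Qed.

Lemma gen_cent_setT x : x \in gen_cent [set: J] [set: J] -> exists c, x = c%:A.
Proof.
move=> /gen_centP[h1 h2].
by apply: (sg_cent sg) => j; [apply: h1|apply: h2]; rewrite in_setT.
Qed.

Lemma setC_ind (P : {set J} -> Prop) : P [set: J]%SET ->
  (forall T j, j \notin T -> P (j |: T) -> P T) -> forall T, P T.
Proof.
move=> P1 PS T; have [n] := ubnP #|~: T|; elim: n T => // n IH T hn.
have [j hj|h] := pickP (mem (~: T)); last first.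
  suff -> : T = [set: J]%SET by [].
  by apply/setP => j; rewrite in_setT; have := h j; rewrite /= in_setC => /negbFE.
rewrite /= in_setC in hj; apply: (PS T j) => //; apply: IH.
rewrite setCU (cardsD1 j) in hn *; move: hn; rewrite in_setC hj add1n ltnS.
apply: leq_trans; rewrite ltnS; apply: subset_leq_card.
by apply/subsetP => i; rewrite !inE.
Qed.

(** Splitting along every [u j] with [j] outside [T0] ends in the scalars, so this centralizer is
    obtained from [F] by adjoining these [v j]. *)
Lemma gen_cent_u_ind (P : A -> Prop) T0 : (forall c, P c%:A) ->
  (forall T x0 x1 j, T0 \subset T -> j \notin T ->
    x0 \in gen_cent [set: J] (j |: T) -> x1 \in gen_cent [set: J] (j |: T) ->
    P x0 -> P x1 -> P (x0 + x1 * v j)) ->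
  forall x, x \in gen_cent [set: J] T0 -> P x.
Proof.
move=> P1 PS; suff h T x : T0 \subset T -> x \in gen_cent [set: J] T -> P x.
  by move=> x; apply: h.
elim/setC_ind: T x => [x _ /gen_cent_setT[c -> //]|T j jT IH x sT].
case/(gen_cent_decomp_u jT) => x0 [x1 [h0 h1 -> _]].
by apply: (PS T) => //; apply: IH => //; apply: (subset_trans sT); exact: subsetU1.
Qed.

Lemma gen_ind (P : A -> Prop) : (forall c, P c%:A) ->
  (forall x y j, P x -> P y -> P (x + y * v j)) ->
  (forall x y j, P x -> P y -> P (x + y * u j)) -> forall x, P x.
Proof.
move=> P1 Pv Pu x.
suff h S : forall x, x \in gen_cent S set0 -> P x.
  by apply: (h set0); apply/gen_centP; split=> j; rewrite inE.
elim/setC_ind: S => {x}.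
  by apply: gen_cent_u_ind => // T x0 x1 j _ _ _ _; exact: Pv.
move=> S j jS IH x; case/(gen_cent_decomp_v jS); first by rewrite inE.
by move=> p [q [hp hq ->]]; apply: Pu; apply: IH.
Qed.

Lemma dim_double (V W : {vspace A}) (f : 'End(A)) :
  (W <= V)%VS -> (f @: W <= V)%VS ->
  (forall x, x \in V -> exists p q, [/\ p \in W, q \in W & x = p + f q]) ->
  (forall q, q \in W -> f q \in W -> q = 0) -> \dim V = (\dim W).*2.
Proof.
move=> sW sf hV inj; have -> : V = (W + f @: W)%VS.
  apply/eqP; rewrite eqEsubv subv_add sW sf !andbT; apply/subvP => x.
  by case/hV=> p [q [hp hq ->]]; rewrite memv_add ?memv_img.
rewrite dimv_disjoint_sum.
  rewrite limg_dim_eq ?addnn //; apply/eqP; rewrite -subv0; apply/subvP => x.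
  rewrite memv_cap memv_ker memv0 => /andP[xW /eqP fx].
  by rewrite (inj x) // fx mem0v.
apply/eqP; rewrite -subv0; apply/subvP => x; rewrite memv_cap memv0.
by case/andP=> xW /memv_imgP[q qW xq]; rewrite xq in xW *; rewrite (inj q) // linear0.
Qed.

Lemma dim_gen_cent T : \dim (gen_cent [set: J] T) = (2 ^ #|~: T|)%N.
Proof.
elim/setC_ind: T => [|T j jT IH].
  rewrite setCT cards0 expn0; apply/eqP; rewrite eqn_leq; apply/andP; split.
    apply: leq_trans (_ : \dim (1%VS : {vspace A}) <= 1)%N; last by rewrite dimv1.
    apply/dimvS/subvP => x /gen_cent_setT[c ->].
    by rewrite memvZ // memv_line.
  rewrite lt0n dimv_eq0; apply/negP => /eqP h.
  by have := gen_cent_scalar [set: J] [set: J] 1; rewrite h memv0 scale1r oner_eq0.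
rewrite (@dim_double _ (gen_cent [set: J] (j |: T)) (amulr (v j))).
- rewrite IH -mul2n -expnS; congr (_ ^ _)%N.
  by rewrite [RHS](cardsD1 j) in_setC jT setCU add1n setIC -setDE.
- by apply/subvP => x; apply: gen_centS => //; exact: subsetU1.
- apply/subvP => _ /memv_imgP[x hx ->]; rewrite lfunE /=.
  have [hx1 hx2] := gen_centP _ _ _ hx.
  apply/gen_centP; split=> i hi; apply/commr_sym/commrM.
  + by apply/commr_sym/hx1.
  + exact: sg_vC sg _ _.
  + by apply/commr_sym/hx2; rewrite in_setU1 hi orbT.
  by apply/commr_sym/(sg_vuC sg); apply: contraNneq jT => ->.
- move=> x /(gen_cent_decomp_u jT)[x0 [x1 [h0 h1 h _]]].
  by exists x0, x1; split=> //; rewrite lfunE.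
move=> q /gen_centP[_ /(_ j)]; rewrite setU11 => /(_ isT) qu.
rewrite lfunE /= => /gen_centP[_ /(_ j)]; rewrite setU11 => /(_ isT) h.
apply: (@mulv_eq0 _ j); transitivity (q * v j * u j + u j * (q * v j)).
  by c2 (tt, esym qu, sg_vu sg j).
by rewrite h (addxx2 charF2).
Qed.

Lemma dim_generated : \dim {:A} = (4 ^ #|J|)%N.
Proof.
suff h S : \dim (gen_cent S set0) = (2 ^ (#|J| + #|~: S|))%N.
  have := h set0; rewrite setC0 cardsT addnn -mul2n expnM => <-.
  congr (\dim _); apply/eqP; rewrite eqEsubv subvf andbT.
  by apply/subvP => x _; apply/gen_centP; split=> j; rewrite inE.
elim/setC_ind: S => [|S j jS IH].
  by rewrite dim_gen_cent setCT setC0 cards0 cardsT addn0.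
have j0 : j \notin @set0 J by rewrite inE.
rewrite (@dim_double _ (gen_cent (j |: S) set0) (amulr (u j))).
- rewrite IH -mul2n -expnS -addnS; congr (_ ^ (_ + _))%N.
  by rewrite [RHS](cardsD1 j) in_setC jS setCU add1n setIC -setDE.
- by apply/subvP => x; apply: gen_centS => //; exact: subsetU1.
- apply/subvP => _ /memv_imgP[x hx ->]; rewrite lfunE /=.
  have [hx1 hx2] := gen_centP _ _ _ hx.
  apply/gen_centP; split=> i hi; last by rewrite inE in hi.
  apply/commr_sym/commrM.
  + by apply/commr_sym/hx1; rewrite in_setU1 hi orbT.
  by apply: (sg_vuC sg); apply: contraNneq jS => <-.
- move=> x /(gen_cent_decomp_v jS j0)[x0 [x1 [h0 h1 h]]].
  by exists x0, x1; split=> //; rewrite lfunE.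
move=> q /gen_centP[/(_ j)]; rewrite setU11 => /(_ isT) qv _.
rewrite lfunE /= => /gen_centP[/(_ j)]; rewrite setU11 => /(_ isT) h _.
apply: (@mulv_eq0 _ j); transitivity (q * u j * v j + v j * (q * u j)).
  by c2 (tt, esym qv, sg_vu sg j).
by rewrite h (addxx2 charF2).
Qed.

End Generators.

(** * The commutative subalgebra of the [v j] and the alternator form *)

Section Alternators.

Variables (F : fieldType) (A : falgType F) (s : A -> A).
Hypothesis charF2 : 2%N \in [pchar F].
Hypothesis orthA : orthogonal_involution s.
Variables (J : finType) (v u : J -> A) (a b : J -> F).
Hypothesis sg : symmetric_generators s v u a b.

Ltac c2 hs := c2_with A charF2 hs.

Local Notation C := (gen_cent v u).
Local Notation Phi := (gen_cent v u [set: J] set0).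

Implicit Types (S T : {set J}) (x y : A) (i j : J).

Let sD : {morph s : x y / x + y}. Proof. by case: orthA => -[]. Qed.
Let sM x y : s (x * y) = s y * s x. Proof. by case: orthA => -[]. Qed.
Let sK : involutive s. Proof. by case: orthA => -[]. Qed.
Let sZ c x : s (c *: x) = c *: s x.
Proof. by case: orthA => h1 h2 _; exact: involutionZ. Qed.
Let s0 : s 0 = 0. Proof. by have := sZ 0 0; rewrite !scale0r. Qed.
Let s1 : s 1 = 1. Proof. by case: orthA => h1 _ _; exact: involution1. Qed.

Lemma gen_cent_Phi T x : x \in C [set: J] T -> x \in Phi.
Proof. by apply: gen_centS => //; exact: sub0set. Qed.

Lemma Phi_comm_v x j : x \in Phi -> GRing.comm x (v j).
Proof. by case/gen_centP=> h _; apply: h; rewrite in_setT. Qed.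

Lemma Phi_comm x y : x \in Phi -> y \in Phi -> GRing.comm x y.
Proof.
move=> hx hy; move: x hx; apply: (gen_cent_u_ind charF2 sg) => [c|].
  by apply/commr_sym/commrZ; exact: commr1.
move=> T x0 x1 j _ _ _ _ h0 h1; apply/commr_sym/commrD; first exact/commr_sym.
by apply: commrM; [exact/commr_sym|exact: Phi_comm_v].
Qed.

Lemma Phi_sym x : x \in Phi -> s x = x.
Proof.
move: x; apply: (gen_cent_u_ind charF2 sg) => [c|]; first by rewrite sZ s1.
move=> T x0 x1 j _ _ _ /gen_cent_Phi hx1 h0 h1.
by rewrite sD sM h0 h1 (sg_sv sg) (Phi_comm_v j hx1).
Qed.

Lemma Phi_sq x : x \in Phi -> exists c, x * x = c%:A.
Proof.
move: x; apply: (gen_cent_u_ind charF2 sg) => [c|].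
  by exists (c * c); rewrite -scalerAl mul1r scalerA.
move=> T x0 x1 j _ _ /gen_cent_Phi hx0 /gen_cent_Phi hx1 [c0 h0] [c1 h1].
exists (c0 + c1 * a j).
by c2 (tt, h0, h1, sg_vv sg j, esym (Phi_comm_v j hx0), esym (Phi_comm_v j hx1),
  Phi_comm hx1 hx0).
Qed.

Lemma AltP x : Alt s x <-> exists y, x = y + s y.
Proof.
split; first by case=> y _ <-; exists y; rewrite (oppx2 charF2).
by case=> y ->; exists y; rewrite ?(oppx2 charF2).
Qed.

Lemma Alt_scalar c : Alt s c%:A -> c = 0.
Proof.
move=> /AltP[y hy]; apply/eqP; apply: contraT => c0; case: orthA => _ _ [].
apply/AltP; exists (c^-1 *: y).
by rewrite sZ -scalerDr -hy scalerA mulVf // scale1r.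
Qed.

(* Comparing the commutators of both sides with [v j] shows that [s q * q], and
   hence [u j * (s q * q) * u j], lies in [Alt s]. *)
Lemma alternator_split S p q j c :
  p \in C (j |: S) set0 -> q \in C (j |: S) set0 ->
  Alt s (s (p + q * u j) * (p + q * u j) + c%:A) ->
  Alt s (s q * q) /\ Alt s (s p * p + c%:A).
Proof.
move=> /gen_centP[hp _] /gen_centP[hq _] /AltP[y hy].
have pv := hp j (setU11 _ _); have qv := hq j (setU11 _ _).
have sv := sg_sv sg j; have su := sg_su sg j.
have pv' : GRing.comm (s p) (v j) by rewrite /GRing.comm -{1}sv -sM -pv sM sv.
have qv' : GRing.comm (s q) (v j) by rewrite /GRing.comm -{1}sv -sM -qv sM sv.
have [y0 [y1 [h0 h1 yE]]] : exists y0 y1, [/\ GRing.comm y0 (v j),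
    GRing.comm y1 (v j) & y = y0 + y1 * u j].
  have j0 : j \notin set0 by rewrite inE.
  have [|y0 [y1 [/gen_centP[h0 _] /gen_centP[h1 _] h]]] :=
    @gen_cent_decomp_v _ _ _ charF2 _ _ _ _ _ sg _ _ y _ j0 j0.
    by apply/gen_centP; split=> i; rewrite inE.
  by exists y0, y1; split=> //; [apply: h0|apply: h1]; exact: setU11.
have h0' : GRing.comm (s y0) (v j) by rewrite /GRing.comm -{1}sv -sM -h0 sM sv.
have h1' : GRing.comm (s y1) (v j) by rewrite /GRing.comm -{1}sv -sM -h1 sM sv.
have sx : s (p + q * u j) = s p + u j * s q by rewrite sD sM su.
have sy : s y = s y0 + u j * s y1 by rewrite yE sD sM su.
pose w := s p * q + s q * q * u j + y1.
have sw : s w = s q * p + u j * (s q * q) + s y1.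
  by rewrite /w !sD !sM !sK su mulrA.
have hSE : s q * q = w + s w.
  pose L := s (p + q * u j) * (p + q * u j) + c%:A.
  have : (s q * q + w + s w) * v j = 0.
    transitivity (v j * (L + (y + s y)) + (L + (y + s y)) * v j).
      rewrite /L sx sy sw yE /w.
      by c2 (tt, pv, qv, pv', qv', h0, h1, h0', h1', sg_uv charF2 sg j).
    by rewrite /L hy (addxx2 charF2) mul0r mulr0 addr0.
  move/(mulv_eq0 sg) => h; transitivity (s q * q + w + s w + w + s w).
    by c2 tt.
  by rewrite h add0r.
clearbody w; split; first by apply/AltP; exists w.
apply/AltP; exists (y + s p * q * u j + u j * w * u j).
transitivity (s (p + q * u j) * (p + q * u j) + c%:A + s p * q * u j +
  u j * s q * p + u j * (s q * q) * u j).
  by rewrite sx; c2 tt.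
by rewrite hy hSE !sD !sM !sK su; c2 tt.
Qed.

Let in_C0 x : x \in C set0 set0.
Proof. by apply/gen_centP; split=> j; rewrite inE. Qed.

(** By [alternator_split], the components of [x] along the [u j] can be discarded one at a time
    without changing [c]. What is left lies in Phi, whose elements are symmetric with scalar
    squares, and no nonzero scalar is alternating. *)
Lemma alternator_value x c : Alt s (s x * x + c%:A) ->
  exists2 y, y \in Phi & y * y = c%:A.
Proof.
suff h S : forall x, x \in C S set0 -> Alt s (s x * x + c%:A) ->
  exists2 y, y \in Phi & y * y = c%:A by exact: (h set0).
elim/setC_ind: S => {x} [x hx|S j jS IH x].
  have [d hd] := Phi_sq hx; rewrite (Phi_sym hx) hd -scalerDl => /Alt_scalar.
  move/eqP; rewrite addr_eq0 (oppr_pchar2 charF2) => /eqP <-.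
  by exists x.
case/(gen_cent_decomp_v charF2 sg jS); first by rewrite inE.
by move=> p [q [hp hq ->]] /(alternator_split hp hq)[_]; exact: IH.
Qed.

(** The same reduction with value [0], continued with the coefficient [q] whenever it is nonzero, so
    that the element never vanishes. *)
Lemma alternator_isotropic x : x != 0 -> Alt s (s x * x) ->
  exists y, [/\ y \in Phi, y != 0 & y * y = 0].
Proof.
suff h S : forall x, x \in C S set0 -> x != 0 -> Alt s (s x * x) ->
  exists y, [/\ y \in Phi, y != 0 & y * y = 0] by exact: (h set0).
elim/setC_ind: S => {x} [x hx x0|S j jS IH x].
  have [d hd] := Phi_sq hx; rewrite (Phi_sym hx) hd => /Alt_scalar d0.
  by exists x; rewrite hd d0 scale0r.
case/(gen_cent_decomp_v charF2 sg jS); first by rewrite inE.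
move=> p [q [hp hq ->]] x0 halt.
have halt0 : Alt s (s (p + q * u j) * (p + q * u j) + 0%:A).
  by rewrite scale0r addr0.
have [h1 h2] := alternator_split hp hq halt0.
have [q0|q0] := eqVneq q 0; last exact: (IH q).
apply: (IH p) => //; first by apply: contraNneq x0 => ->; rewrite q0 mul0r addr0.
by rewrite scale0r addr0 in h2.
Qed.

Lemma Phi_alternator x c : x \in Phi -> x * x = c%:A ->
  alternator_subalgebra s x /\ alternator_form s x = c.
Proof.
move=> hx hc; have alt0 : Alt s 0 by apply/AltP; exists 0; rewrite s0 addr0.
split; first by exists c, 0; rewrite (Phi_sym hx) hc addr0.
rewrite /alternator_form; apply: xget_unique.
  by rewrite /= (Phi_sym hx) hc (addxx2 charF2).
move=> d; rewrite /= (Phi_sym hx) hc -scalerDl => /Alt_scalar /eqP.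
by rewrite addr_eq0 (oppr_pchar2 charF2) => /eqP ->.
Qed.

Lemma alternator_form_value x : alternator_subalgebra s x ->
  exists2 y, y \in Phi & y * y = (alternator_form s x)%:A.
Proof.
case=> c [w [hw hx]]; apply: (@alternator_value x).
rewrite /alternator_form; case: xgetP => [d -> //|].
(* The default value of [xget] does not occur, because [c] satisfies the condition. *)
move/(_ c) => [] /=; rewrite hx.
by have -> : c%:A + w + c%:A = w by c2 tt.
Qed.

(** As [v j = u j * v j + v j * u j], an element [x1 * v j] with [x1] in Phi commuting with [u j] is
    [z + s z] for [z = x1 * u j * v j]. Only indices [j] outside [T] occur, hence [j != k]. *)
Lemma gen_cent_trace_form T k x : k \in T -> x \in C [set: J] T ->
  exists c z, [/\ x = c%:A + z + s z, GRing.comm z (v k) & GRing.comm z (u k)].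
Proof.
move=> kT; move: x; apply: (gen_cent_u_ind charF2 sg) => [c|].
  exists c, 0; split; [|exact/commr_sym/commr0|exact/commr_sym/commr0].
  by rewrite s0 !addr0.
move=> T' x0 x1 j sT jT' _ hx1 [c [z [-> zv zu]]] _.
have /gen_centP[_ x1u] := hx1; have hP := gen_cent_Phi hx1.
have jk : j != k by apply: contraNneq jT' => ->; exact: (fintype.subsetP sT).
have w : GRing.comm (x1 * u j * v j) (v k) /\ GRing.comm (x1 * u j * v j) (u k).
  split; apply/commr_sym/commrM.
  - apply: commrM; first exact/commr_sym/Phi_comm_v.
    by apply: (sg_vuC sg); rewrite eq_sym.
  - exact: sg_vC sg _ _.
  - apply: commrM; last exact: sg_uC sg _ _.
    by apply/commr_sym/x1u; rewrite in_setU1 (fintype.subsetP sT) ?orbT.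
  exact/commr_sym/(sg_vuC sg).
exists c, (z + x1 * u j * v j); case: w => wv wu.
split; [|exact/commr_sym/commrD/commr_sym|exact/commr_sym/commrD/commr_sym].
rewrite sD !sM (sg_sv sg) (sg_su sg) (Phi_sym hP).
have xu := x1u j (setU11 _ _).
by c2 (tt, esym xu, sg_vu sg j, esym (Phi_comm_v j hP)).
Qed.

End Alternators.

(** * Normal form of the generators *)

Section Exchange.

Variables (F : fieldType) (A : falgType F) (s : A -> A).
Hypothesis charF2 : 2%N \in [pchar F].
Hypothesis orthA : orthogonal_involution s.
Variables (J : finType) (v u : J -> A) (a b : J -> F).
Hypothesis sg : symmetric_generators s v u a b.

Ltac c2 hs := c2_with A charF2 hs.

Local Notation C := (gen_cent v u).

Variables (j : J) (p : A).
Hypothesis hp : p \in C [set: J] [set j].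
Hypothesis pp : p * p = (a j)%:A.

(** [q] is the inverse of [p], and [c i] below is the logarithmic derivative of [p] for the
    commutator with [u i]. *)
Let q := (a j)^-1 *: p.
Let d i := u i * p + p * u i.
Let c i := d i * q.

Let qC : q \in C [set: J] [set j].
Proof. by rewrite memvZ. Qed.

Let dC i : d i \in C [set: J] [set j].
Proof. exact: (gen_cent_ad charF2 sg). Qed.

Let cC i : c i \in C [set: J] [set j].
Proof. exact: gen_centM. Qed.

Let comm_uj x : x \in C [set: J] [set j] -> GRing.comm (u j) x.
Proof. by move=> /gen_centP[_ h]; apply/commr_sym/h/set11. Qed.

Let comm_vi x i : x \in C [set: J] [set j] -> GRing.comm (v i) x.
Proof. by move=> /gen_centP[h _]; apply/commr_sym/h; rewrite in_setT. Qed.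

Let comm_C x y : x \in C [set: J] [set j] -> y \in C [set: J] [set j] -> GRing.comm x y.
Proof.
by move=> /(gen_cent_Phi) hx /gen_cent_Phi; exact: (Phi_comm charF2 sg).
Qed.

Let qq : q * q = (a j)^-1%:A.
Proof.
rewrite /q -scalerAl -scalerAr pp !scalerA; congr (_ *: _).
by rewrite -mulrA mulVf ?mulr1 // (sg_a0 sg).
Qed.

Let pq : p * q = 1.
Proof. by rewrite /q -scalerAr pp scalerA mulVf ?scale1r // (sg_a0 sg). Qed.

Let uq i : u i * q = q * u i + d i * q * q.
Proof.
rewrite -mulrA qq mulr_algr /q /d; c2 tt.
Qed.

Let ud i : u i * d i = d i * u i + d i.
Proof. by rewrite /d; c2 (tt, sg_uu sg i). Qed.

Let udC i l : u l * d i = d i * u l + u i * d l + d l * u i.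
Proof. by rewrite /d; c2 (tt, sg_uC sg i l). Qed.

(** A logarithmic derivative for an idempotent derivation satisfies this Riccati-type identity,
    which makes [u' i * u' i] equal to [u' i] plus a scalar. *)
Let uc i : u i * c i = c i * u i + c i + c i * c i.
Proof. by rewrite /c; c2 (tt, uq i, ud i, comm_C qC (dC i)). Qed.

(** The derivations commute, so mixed derivatives agree; this makes the [u' i] commute. *)
Let ucC i l : u l * c i = c i * u l + u i * c l + c l * u i.
Proof.
have [->|il] := eqVneq i l; first by c2 tt.
by rewrite /c; c2 (tt, uq l, uq i, udC i l, comm_C qC (dC i), comm_C qC (dC l),
  comm_C (dC l) (dC i)).
Qed.

Let c_j : c j = 0.
Proof. by rewrite /c /d (comm_uj hp) (addxx2 charF2) mul0r. Qed.

Let v' i := if i == j then v j * q else v i.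
(** The term [c i * u j] compensates the commutator of [u i] with the factor [q] of [v' j], so that
    [u' i] commutes with [v' j] for [i != j]. *)
Let u' i := u i + c i * u j.

Let v'C i : v' i \in C [set: J] set0.
Proof.
have vC k : v k \in C [set: J] set0.
  by apply/gen_centP; split=> l; [move=> _; exact: sg_vC sg _ _|rewrite inE].
by rewrite /v'; case: eqP => // _; apply: gen_centM => //; exact: gen_cent_Phi qC.
Qed.

Let u'_j : u' j = u j.
Proof. by rewrite /u' c_j mul0r addr0. Qed.

Let uj_u' i : GRing.comm (u j) (u' i).
Proof.
apply: commrD; first exact: sg_uC sg _ _.
by apply: commrM; [exact: comm_uj|exact: commr_refl].
Qed.

Lemma exchange_generators : exists (v' u' : J -> A) (a' b' : J -> F),
  symmetric_generators s v' u' a' b' /\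
  forall i, a' i = if i == j then 1 else a i.
Proof.
have [sD sM sK] : involution s by case: orthA.
have [i|g hg] := @choice _ _ (fun i k => c i * c i = k%:A).
  by apply: (Phi_sq charF2 sg); exact: gen_cent_Phi (cC i).
exists v', u', (fun i => if i == j then 1 else a i), (fun i => b i + g i * b j).
split=> //; split.
- by move=> i; case: (i == j); [rewrite oner_eq0|exact: sg_a0 sg i].
- move=> i; rewrite /v'; case: eqP => _; last exact: sg_vv sg i.
  transitivity (v j * v j * (q * q)); first by c2 (tt, esym (comm_vi j qC)).
  rewrite (sg_vv sg) qq -scalerAl mul1r scalerA mulfV ?scale1r //.
  exact: sg_a0 sg j.
- move=> i; have [->|ij] := eqVneq i j.
    have -> : g j = 0.
      have /eqP := hg j; rewrite c_j mul0r eq_sym scaler_eq0 oner_eq0 orbF.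
      by move/eqP.
    by rewrite u'_j mul0r addr0; exact: sg_uu sg j.
  by rewrite /u'; c2 (tt, sg_uu sg i, sg_uu sg j, uc i, hg i, comm_uj (cC i),
    sg_uC sg j i).
- move=> i; rewrite /v'; have [->|ij] := eqVneq i j.
    by rewrite u'_j; c2 (tt, sg_vu sg j, esym (comm_uj qC)).
  by rewrite /u'; c2 (tt, sg_vu sg i, comm_vi i (cC i), sg_vuC sg ij).
- by move=> i l; exact: (Phi_comm charF2 sg).
- move=> i l; have [->|ij] := eqVneq i j; first by rewrite u'_j.
  have [->|lj] := eqVneq l j; first by rewrite u'_j; apply/commr_sym.
  have [->|il] := eqVneq i l; first exact: commr_refl.
  rewrite /u' /GRing.comm.
  by c2 (tt, comm_uj (cC i), comm_uj (cC l), sg_uC sg j i, sg_uC sg j l, ucC i l,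
    sg_uC sg l i, comm_C (cC l) (cC i)).
- move=> i l il; rewrite /v'; have [ij|ij] := eqVneq i j; last first.
    apply: commrD; first exact: (sg_vuC sg il).
    by apply: commrM; [exact: comm_vi|exact: (sg_vuC sg ij)].
  have jl : j != l by rewrite -ij.
  rewrite /u' /c /GRing.comm.
  by c2 (tt, esym (sg_vuC sg jl), sg_uv charF2 sg j, comm_uj qC,
    comm_uj (dC l), esym (comm_vi j qC), esym (comm_vi j (dC l)),
    comm_C qC (dC l), uq l).
- by move=> i; exact: (Phi_sym charF2 orthA sg).
- move=> i; rewrite /u' sD sM !(sg_su sg) (Phi_sym charF2 orthA sg); last first.
    exact: gen_cent_Phi (cC i).
  by rewrite (comm_uj (cC i)).
(* The old generators are recovered: [u' j] is [u j], the unchanged [v i] with [i != j] generate [p]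
   and the [c i], whence [v j = v' j * p] and [u i = u' i + c i * u j]. *)
move=> x xv xu; have xuj : GRing.comm x (u j) by rewrite -u'_j.
have xC y : y \in C [set: J] [set j] -> GRing.comm x y.
  move: y; apply: (gen_cent_u_ind charF2 sg) => [k|].
    by apply: commrZ; exact: commr1.
  move=> T x0 x1 i sT iT _ _ h0 h1; apply: commrD => //; apply: commrM => //.
  have := xv i; rewrite /v'; case: eqP => // ij.
  by case/negP: iT; apply: (fintype.subsetP sT); rewrite ij set11.
apply: (sg_cent sg) => i.
  have [->|ij] := eqVneq i j; last by have := xv i; rewrite /v' (negbTE ij).
  have -> : v j = v' j * p.
    rewrite /v' eqxx -mulrA (_ : q * p = 1) ?mulr1 // -pq.
    by apply: comm_C.
  by apply: commrM; [exact: xv|exact: xC].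
have -> : u i = u' i + c i * u j by rewrite /u'; c2 tt.
by apply: commrD => //; apply: commrM => //; exact: xC.
Qed.

End Exchange.

Section NormalForm.

Variables (F : fieldType) (A : falgType F) (s : A -> A).
Hypothesis charF2 : 2%N \in [pchar F].
Hypothesis orthA : orthogonal_involution s.
Variables (J : finType).

(** Write [x = y + z * v j]. If [z * z] is nonzero, then [x * x = 0] says that [y] times the inverse
    of [z] has square [a j]; otherwise [z], or [y] if [z] vanishes, is a square-zero element
    involving fewer of the [v j]. *)
Lemma nilpotent_exchange (v u : J -> A) (a b : J -> F) (T : {set J}) x :
  symmetric_generators s v u a b ->
  x \in gen_cent v u [set: J] T -> x * x = 0 -> x != 0 ->
  exists j p, [/\ j \notin T, p \in gen_cent v u [set: J] [set j] &
    p * p = (a j)%:A].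
Proof.
move=> sg; elim/setC_ind: T x => [x /(gen_cent_setT sg)[c ->]|T j jT IH x].
  rewrite -scalerAl mul1r scalerA => /eqP.
  by rewrite !scaler_eq0 mulf_eq0 orbb oner_eq0 orbF => /eqP -> /eqP.
have sub k : k \notin j |: T -> k \notin T.
  by apply: contra => ?; rewrite in_setU1 orbC; apply/orP; left.
case/(gen_cent_decomp_u charF2 sg jT) => y [z [hy hz -> _]] yz0 x0.
have [z0|z0] := eqVneq z 0.
  move: yz0 x0; rewrite z0 mul0r addr0 => h1 h2.
  by have [k [p [h3 h4 h5]]] := IH y hy h1 h2; exists k, p; split=> //; exact: sub.
have [zz|zz] := eqVneq (z * z) 0.
  by have [k [p [h3 h4 h5]]] := IH z hz zz z0; exists k, p; split=> //; exact: sub.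
have hyP := gen_cent_Phi hy; have hzP := gen_cent_Phi hz.
have [d hd] := Phi_sq charF2 sg hzP; have [e he] := Phi_sq charF2 sg hyP.
have d0 : d != 0 by apply: contraNneq zz => d0; rewrite hd d0 scale0r.
have ed : e = d * a j.
  have h : (e + d * a j)%:A = 0 :> A.
    rewrite -yz0; c2_with A charF2 (tt, he, hd, sg_vv sg j,
      esym (Phi_comm_v j hyP), esym (Phi_comm_v j hzP), Phi_comm charF2 sg hzP hyP).
  move/eqP: h; rewrite scaler_eq0 oner_eq0 orbF addr_eq0 (oppr_pchar2 charF2).
  by move/eqP.
exists j, (d^-1 *: (y * z)); split=> //.
  apply: memvZ; apply: gen_centM.
    by apply: gen_centS hy => //; rewrite sub1set setU11.
  by apply: gen_centS hz => //; rewrite sub1set setU11.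
transitivity ((d^-1 * d^-1) *: ((y * y) * (z * z))).
  by c2_with A charF2 (tt, Phi_comm charF2 sg hzP hyP).
rewrite he hd -scalerAl mul1r !scalerA ed; congr (_ *: _).
by field.
Qed.

(** Start with [I] all of [J]. While K contains a nonzero square-zero element, an exchange makes
    some [a j] with [j] in [I] equal to [1], and this [j] leaves [I]. *)
Lemma anisotropic_generators (v u : J -> A) (a b : J -> F) :
  symmetric_generators s v u a b ->
  exists (I : {set J}) (v u : J -> A) (a b : J -> F),
    [/\ symmetric_generators s v u a b, forall k, k \notin I -> a k = 1 &
      forall x, x \in gen_cent v u [set: J] (~: I) -> x * x = 0 -> x = 0].
Proof.
suff h n : forall (I : {set J}) (v u : J -> A) (a b : J -> F), (#|I| < n)%N ->
  symmetric_generators s v u a b -> (forall k, k \notin I -> a k = 1) ->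
  exists (I : {set J}) (v u : J -> A) (a b : J -> F),
    [/\ symmetric_generators s v u a b, forall k, k \notin I -> a k = 1 &
      forall x, x \in gen_cent v u [set: J] (~: I) -> x * x = 0 -> x = 0].
  by move=> sg; apply: (h _ [set: J]%SET) (ltnSn _) sg _ => k; rewrite in_setT.
elim: n => // n IH I {}v {}u {}a {}b hn sg hI.
have [h|] := EM (forall x, x \in gen_cent v u [set: J] (~: I) -> x * x = 0 -> x = 0).
  by exists I, v, u, a, b; split.
case/existsNP => x /not_implyP[hx /not_implyP[xx /eqP x0]].
have [j [p [jI hp pp]]] := nilpotent_exchange sg hx xx x0.
have [v' [u' [a' [b' [sg' ha']]]]] := exchange_generators charF2 orthA sg hp pp.
rewrite in_setC negbK in jI.
apply: (IH (I :\ j) v' u' a' b') => //.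
  by move: hn; rewrite (cardsD1 j) jI add1n ltnS.
move=> k; rewrite !inE negb_and negbK ha'; case: eqP => //= _ /hI.
exact.
Qed.

Lemma normal_generators (v u : J -> A) (a b : J -> F) :
  symmetric_generators s v u a b ->
  exists (I : {set J}) (v u : J -> A) (a b : J -> F),
    [/\ symmetric_generators s v u a b,
      forall k, k \notin I -> a k = 1, forall k, k \notin I -> b k = 0 &
      forall x, x \in gen_cent v u [set: J] (~: I) -> x * x = 0 -> x = 0].
Proof.
move=> /anisotropic_generators[I {v u a b} [v [u [a [b [sg ha aniso]]]]]].
have [sD sM sK] : involution s by case: orthA.
have sZ : forall c x, s (c *: x) = c *: s x.
  by case: orthA => h1 h2 _; exact: involutionZ.
have s1 : s 1 = 1 by case: orthA => h _ _; exact: involution1.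
(* For [k] outside [I], [a k = 1] gives [1 + v k] square zero, and adding [e k *: (1 + v k)] to
   [u k] changes [b k] into [b k + e k]. *)
pose e k := if k \in I then 0 else b k.
pose u' k := u k + e k *: (1 + v k).
have vu' i j : i != j -> GRing.comm (v i) (u' j).
  move=> ij; apply: commrD; first exact: (sg_vuC sg ij).
  by apply/commrZ/commrD; [exact: commr1|exact: sg_vC sg _ _].
have xuu' x k : GRing.comm x (v k) -> GRing.comm x (u' k) <-> GRing.comm x (u k).
  move=> xv; have h : GRing.comm x (e k *: (1 + v k)).
    by apply/commrZ/commrD => //; exact: commr1.
  split=> xu; last exact: commrD.
  have -> : u k = u' k + e k *: (1 + v k) by rewrite /u'; c2_with A charF2 tt.
  exact: commrD.
exists I, v, u', a, (fun k => if k \in I then b k else 0); split=> //.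
- split; try by case: sg.
  + move=> k; rewrite /u' /e; case: ifP => kI.
      by rewrite scale0r !addr0; exact: sg_uu sg k.
    have ak : v k * v k = 1 by rewrite (sg_vv sg) ha ?kI ?scale1r.
    by rewrite scale0r; c2_with A charF2 (tt, ak, sg_vu sg k, sg_uu sg k).
  + by move=> k; rewrite /u'; c2_with A charF2 (tt, sg_vu sg k).
  + move=> i j; have [->|ij] := eqVneq i j; first exact: commr_refl.
    apply: commrD; last first.
      by apply/commrZ/commrD; [exact: commr1|apply/commr_sym/vu'; rewrite eq_sym].
    apply/commr_sym/commrD; first exact: sg_uC sg _ _.
    apply/commrZ/commrD; first exact: commr1.
    by apply/commr_sym/(sg_vuC sg).
  + by move=> k; rewrite /u' sD sZ sD s1 (sg_sv sg) (sg_su sg).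
  move=> x xv xu; apply: (sg_cent sg) => // k.
  by apply/xuu'.
- by move=> k /negbTE ->.
move=> x /gen_centP[h1 h2]; apply: aniso; apply/gen_centP; split=> // k kI.
by apply/xuu'; [apply: h1; rewrite in_setT|exact: h2].
Qed.

End NormalForm.

(** * Intertwiners *)

Record partial_generators (F : fieldType) (A : falgType F) (J : finType)
    (T : {set J}) (v u : J -> A) (a b : J -> F) : Prop := PartialGenerators {
  pg_vv : forall j, v j * v j = (a j)%:A;
  pg_uu : forall j, j \in T -> u j * u j = u j + (b j)%:A;
  pg_vu : forall j, j \in T -> v j * u j = u j * v j + v j;
  pg_vC : forall i j, GRing.comm (v i) (v j);
  pg_uC : forall i j, i \in T -> j \in T -> GRing.comm (u i) (u j);
  pg_vuC : forall i j, j \in T -> i != j -> GRing.comm (v i) (u j) }.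

Lemma generators_partial (F : fieldType) (A : falgType F) (s : A -> A)
    (J : finType) (T : {set J}) (v u : J -> A) (a b : J -> F) :
  symmetric_generators s v u a b -> partial_generators T v u a b.
Proof. by case=> h1 h2 h3 h4 h5 h6 h7 *; split=> // *; exact: h7. Qed.

Lemma partial_generators_morph (F : fieldType) (A B : falgType F)
    (f : {lrmorphism A -> B}) (J : finType) (T : {set J}) (v u : J -> A)
    (a b : J -> F) :
  partial_generators T v u a b -> partial_generators T (f \o v) (f \o u) a b.
Proof.
case=> h1 h2 h3 h4 h5 h6; split=> /= *; rewrite /GRing.comm -!rmorphM /=.
- by rewrite h1 rmorph_alg.
- by rewrite h2 // rmorphD /= rmorph_alg.
- by rewrite h3 // rmorphD.
- by rewrite h4.
- by rewrite h5.
by rewrite h6.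
Qed.

Section Intertwiner.

Variables (F : fieldType) (A : falgType F).
Hypothesis charF2 : 2%N \in [pchar F].
Variables (J : finType) (T : {set J}) (v u v' u' : J -> A) (a b : J -> F).
Hypothesis a0 : forall j, a j != 0.
Hypothesis pg : partial_generators T v u a b.
Hypothesis pg' : partial_generators T v' u' a b.

Ltac c2 hs := c2_with A charF2 hs.

Let w j := (a j)^-1 *: v j.

Let wv j : w j * v j = 1.
Proof. by rewrite /w -scalerAl (pg_vv pg) scalerA mulVf // scale1r. Qed.

Let vw j : v j * w j = 1.
Proof. by rewrite /w -scalerAr (pg_vv pg) scalerA mulVf // scale1r. Qed.

(* Averaging over [v j] gives [y + v' y v^-1]; if it vanishes then [y] itself
   already intertwines, since [-1 = 1]. *)
Lemma intertwiner_v (S : {set J}) :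
  exists2 y, y != 0 & forall j, j \notin S -> v' j * y = y * v j.
Proof.
elim/setC_ind: S => [|S j jS [y y0 hy]].
  by exists 1; [rewrite oner_eq0|move=> j; rewrite in_setT].
have sub i : i \notin S -> i != j -> i \notin j |: S.
  by rewrite in_setU1 negb_or => -> ->.
have [z0|z0] := eqVneq (y + v' j * y * w j) 0.
  exists y => // i iS; have [->|ij] := eqVneq i j; last exact/hy/sub.
  transitivity (v' j * y + (y + v' j * y * w j) * v j); last by c2 (tt, wv j).
  by rewrite z0 mul0r addr0.
exists (y + v' j * y * w j) => // i iS; have [->|ij] := eqVneq i j.
  have avw : (a j)%:A * y * w j = y * v j.
    rewrite -(pg_vv pg); have vvy : v j * v j * y = y * (v j * v j).
      by c2 (tt, pg_vv pg j).
    by rewrite vvy -!mulrA vw mulr1.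
  rewrite mulrDr !mulrA (pg_vv pg') avw.
  by c2 (tt, wv j).
have iw : GRing.comm (v i) (w j) by apply: commrZ; exact: pg_vC pg _ _.
by c2 (tt, esym iw, hy i (sub i iS ij), pg_vC pg' i j).
Qed.

(** The [u j] are treated after the [v j], one at a time. The map sending [y] to
    [u' j * y + y * u j] is idempotent, so adding [y] to its value gives an intertwiner; if that sum
    is zero, [y] has eigenvalue [1] and [y * v j] has eigenvalue [0]. *)
Lemma intertwiner : exists y, [/\ y != 0, forall j, v' j * y = y * v j &
  forall k, k \in T -> u' k * y = y * u k].
Proof.
suff h (S : {set J}) : exists y, [/\ y != 0, forall j, v' j * y = y * v j &
    forall k, k \in T -> k \notin S -> u' k * y = y * u k].
  have [y [y0 h1 h2]] := h set0; exists y; split=> // k kT.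
  by apply: h2; rewrite ?inE.
elim/setC_ind: S => [|S j jS [y [y0 hv hu]]].
  have [y y0 hy] := intertwiner_v set0; exists y; split=> // [j|k _ kS].
    by apply: hy; rewrite inE.
  by move: kS; rewrite in_setT.
have sub i : i \notin S -> i != j -> i \notin j |: S.
  by rewrite in_setU1 negb_or => -> ->.
have [jT|jT] := boolP (j \in T); last first.
  exists y; split=> // k kT kS; apply: hu => //; apply: sub => //.
  by apply: contraNneq jT => <-.
have vu := pg_vu pg jT; have vu' := pg_vu pg' jT.
have [t0|t0] := eqVneq (u' j * y + y * u j + y) 0.
  exists (y * v j); split.
  - apply: contraNneq y0 => h.
    by rewrite -[y]mulr1 -(vw j) mulrA h mul0r.
  - by move=> i; rewrite mulrA hv -!mulrA (pg_vC pg).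
  move=> k kT kS; have [->|kj] := eqVneq k j; last first.
    rewrite mulrA hu ?sub // -!mulrA; congr (_ * _); apply/esym.
    by apply: (pg_vuC pg) => //; rewrite eq_sym.
  transitivity (u' j * (y * v j) + (u' j * y + y * u j + y) * v j).
    by rewrite t0 mul0r addr0.
  by c2 (tt, vu).
exists (u' j * y + y * u j + y); split=> //.
- move=> i; have [->|ij] := eqVneq i j.
    by c2 (tt, vu, vu', hv j).
  by c2 (tt, hv i, pg_vuC pg jT ij, pg_vuC pg' jT ij).
move=> k kT kS; have [->|kj] := eqVneq k j.
  by c2 (tt, pg_uu pg jT, pg_uu pg' jT).
by c2 (tt, hu k kT (sub k kS kj), pg_uC pg jT kT, pg_uC pg' kT jT).
Qed.

End Intertwiner.

(** * Units, invertibility of intertwiners and conjugation *)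

Lemma injective_unit (F : fieldType) (A : falgType F) (y : A) :
  (forall t, y * t = 0 -> t = 0) -> exists z, z * y = 1 /\ y * z = 1.
Proof.
move=> inj; have k0 : lker (amull y) = 0%VS.
  apply/eqP; rewrite -subv0; apply/subvP => t.
  by rewrite memv_ker lfunE /= memv0 => /eqP /inj ->.
have lf : limg (amull y) = {:A}%VS.
  apply/eqP; rewrite eqEdim subvf -(limg_ker_dim (amull y) {:A}).
  by rewrite k0 capv0 dimv0 add0n leqnn.
have : 1 \in limg (amull y) by rewrite lf memvf.
case/memv_imgP=> z _; rewrite lfunE /= => yz; exists z; split=> //.
apply/eqP; rewrite -subr_eq0; apply/eqP/inj.
by rewrite mulrBr mulrA -yz mul1r mulr1 subrr.
Qed.

Lemma left_inverse_unit (F : fieldType) (A : falgType F) (x y : A) :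
  x * y = 1 -> y * x = 1.
Proof.
move=> xy; have [t h|z [_ yz]] := @injective_unit _ _ y.
  by rewrite -[t]mul1r -xy -mulrA h mulr0.
by rewrite -[x]mulr1 -yz [x * _]mulrA xy mul1r.
Qed.

Section IntertwinerUnit.

Variables (F : fieldType) (A B : falgType F) (s : A -> A).
Hypothesis charF2 : 2%N \in [pchar F].
Variables (J : finType) (v u : J -> A) (a b : J -> F).
Hypothesis sg : symmetric_generators s v u a b.
Variable T : {set J}.
Hypothesis aniso : forall x, x \in gen_cent v u [set: J] T -> x * x = 0 -> x = 0.
Variables (f : {lrmorphism A -> B}) (v' u' : J -> B) (y : B).
Hypothesis f_bij : bijective f.
Hypothesis y0 : y != 0.
Hypothesis yv : forall j, v' j * y = y * f (v j).
Hypothesis yu : forall j, j \in T -> u' j * y = y * f (u j).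

Ltac c2 hs := c2_with A charF2 hs.

(** Pulled back along [f], this is the right annihilator of [y]: a right ideal of [A], stable under
    left multiplication by the [v j] and, for [j] in [T], by the [u j]. *)
Let N x := y * f x = 0.

Let N_D x1 x2 : N x1 -> N x2 -> N (x1 + x2).
Proof. by rewrite /N rmorphD mulrDr => -> ->; rewrite addr0. Qed.

Let N_r x1 x2 : N x1 -> N (x1 * x2).
Proof. by rewrite /N rmorphM mulrA => ->; rewrite mul0r. Qed.

Let N_v x j : N x -> N (v j * x).
Proof. by rewrite /N rmorphM mulrA -yv -mulrA => ->; rewrite mulr0. Qed.

Let N_u x j : j \in T -> N x -> N (u j * x).
Proof. by move=> jT; rewrite /N rmorphM mulrA -yu // -mulrA => ->; rewrite mulr0. Qed.

Let N_Kv x j : N (x * v j) -> N x.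
Proof. by move=> h; rewrite -[x]mulr1 -(vinvK sg j) mulrA; exact: N_r. Qed.

(** For [j] in [T] the commutator with [u j] isolates [x1 * v j], so both components of [x] stay in
    [N]. What remains is anisotropic: a nonzero element there has a nonzero scalar square, and [N]
    would contain [1]. *)
Let N_Phi (S : {set J}) x : x \in gen_cent v u [set: J] (T :&: S) -> N x -> x = 0.
Proof.
elim/setC_ind: S x => [|S j jS IH] x.
  rewrite setIT => hx Nx; have [c hc] := Phi_sq charF2 sg (gen_cent_Phi hx).
  apply: aniso => //; apply/eqP; rewrite hc scaler_eq0 oner_eq0 orbF.
  apply: contraT => c0; have : N (x * x * (c^-1 *: 1)) by apply/N_r/N_r.
  rewrite hc -scalerAl mul1r scalerA mulfV // scale1r /N rmorph1 mulr1 => /eqP.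
  by rewrite (negbTE y0).
have [jT|jT] := boolP (j \in T); last first.
  suff -> : T :&: S = T :&: (j |: S) by exact: IH.
  apply/setP => k; rewrite !inE; case: eqP => //= ->.
  by rewrite (negbTE jT).
have jTS : j \notin T :&: S by rewrite inE negb_and jS orbT.
have TS : j |: (T :&: S) = T :&: (j |: S).
  by apply/setP => k; rewrite !inE; case: eqP => //= ->; rewrite jT.
case/(gen_cent_decomp_u charF2 sg jTS) => x0 [x1 [h0 h1 xE hw]] Nx.
rewrite TS in h0 h1; have N1v : N (x1 * v j).
  by rewrite hw; apply: N_D; [exact: N_u|exact: N_r].
have x10 := IH _ h1 (N_Kv N1v); rewrite xE x10 mul0r addr0; apply: IH => //.
by rewrite x10 mul0r addr0 in xE; rewrite -xE.
Qed.

(** Commutators with the [v j] isolate the coefficients of the [u j] and reduce the vanishing of [N]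
    to [N_Phi]. *)
Lemma intertwiner_unit : exists z, z * y = 1 /\ y * z = 1.
Proof.
apply: injective_unit => t yt; have [g fK gK] := f_bij.
rewrite -[t]gK; suff -> : g t = 0 by rewrite rmorph0.
have : N (g t) by rewrite /N gK.
suff h (S : {set J}) x : x \in gen_cent v u S set0 -> N x -> x = 0.
  by apply: (h set0); apply/gen_centP; split=> j; rewrite inE.
elim/setC_ind: S x => [|S j jS IH] x.
  by rewrite -(setI0 T); exact: N_Phi.
case/(gen_cent_decomp_v charF2 sg jS); first by rewrite inE.
move=> p [q [hp hq xE]] Nx.
have pv : GRing.comm p (v j) by case/gen_centP: hp => h _; apply/h/setU11.
have qv : GRing.comm q (v j) by case/gen_centP: hq => h _; apply/h/setU11.
have q0 : q = 0.
  apply: IH => //; apply: (@N_Kv _ j).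
  have -> : q * v j = v j * x + x * v j.
    by rewrite xE; c2 (tt, pv, qv, sg_uv charF2 sg j).
  by apply: N_D; [exact: N_v|exact: N_r].
rewrite xE q0 mul0r addr0; apply: IH => //.
by rewrite q0 mul0r addr0 in xE; rewrite -xE.
Qed.

End IntertwinerUnit.

Lemma conjugate_morphism (F : fieldType) (A B : falgType F)
    (f : {lrmorphism A -> B}) (y z : B) :
  bijective f -> y * z = 1 -> z * y = 1 ->
  exists2 g : {lrmorphism A -> B}, bijective g & forall x, g x = y * f x * z.
Proof.
move=> [f' fK f'K] yz zy; pose g x := y * f x * z.
have gL c x1 x2 : g (c *: x1 + x2) = c *: g x1 + g x2.
  by rewrite /g linearP mulrDr mulrDl -scalerAr -scalerAl.
have gM : monoid_morphism g.
  split; first by rewrite /g rmorph1 mulr1.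
  move=> x1 x2; rewrite /g rmorphM -!mulrA; congr (_ * (_ * _)).
  by rewrite [z * _]mulrA zy mul1r.
exists (HB.pack_for {lrmorphism A -> B} g (GRing.isLinear.Build F A B _ g gL)
  (GRing.isMonoidMorphism.Build A B g gM)) => //=.
exists (fun x => f' (z * x * y)) => x /=; rewrite /g.
  by rewrite !mulrA zy mul1r -mulrA zy mulr1 fK.
by rewrite f'K !mulrA yz mul1r -mulrA yz mulr1.
Qed.

(** * Isotropic involutions with the same symmetric generators *)

Section Core.

Variables (F : fieldType) (A : falgType F) (s t : A -> A).
Hypothesis charF2 : 2%N \in [pchar F].
Hypothesis orthS : orthogonal_involution s.
Hypothesis orthT : orthogonal_involution t.
Variables (J : finType) (v u : J -> A) (a b : J -> F) (I : {set J}) (k : J).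
Hypothesis sg : symmetric_generators s v u a b.
Hypothesis a1 : forall j, j \notin I -> a j = 1.
Hypothesis tv : forall j, t (v j) = v j.
Hypothesis tu : forall j, j \notin I -> t (u j) = u j.
Hypothesis kI : k \notin I.

Ltac c2 hs := c2_with A charF2 hs.

Let sD : {morph s : x y / x + y}. Proof. by case: orthS => -[]. Qed.
Let sM x y : s (x * y) = s y * s x. Proof. by case: orthS => -[]. Qed.
Let sK : involutive s. Proof. by case: orthS => -[]. Qed.
Let sZ c x : s (c *: x) = c *: s x.
Proof. by case: orthS => h1 h2 _; exact: involutionZ. Qed.
Let s1 : s 1 = 1. Proof. by case: orthS => h1 _ _; exact: involution1. Qed.
Let tD : {morph t : x y / x + y}. Proof. by case: orthT => -[]. Qed.
Let tM x y : t (x * y) = t y * t x. Proof. by case: orthT => -[]. Qed.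
Let tZ c x : t (c *: x) = c *: t x.
Proof. by case: orthT => h1 h2 _; exact: involutionZ. Qed.
Let t1 : t 1 = 1. Proof. by case: orthT => h1 _ _; exact: involution1. Qed.

(** As [t] fixes the [v j], the [v j] and [t (u j)] satisfy the relations of the [v j] and [u j]. An
    intertwiner [g] of the two systems satisfies [t x * g = g * s x] on generators, and it lies in K
    because [t] fixes [u j] for [j] outside [I]. *)
Lemma involutions_inner : exists g h, [/\ g * h = 1, h * g = 1,
  g \in gen_cent v u [set: J] (~: I) & forall x, t x * g = g * s x].
Proof.
have pg := generators_partial [set: J]%SET sg.
have pg' : partial_generators [set: J] v (t \o u) a b.
  split=> /=.
  - exact: pg_vv pg.
  - by move=> j _; rewrite -tM (sg_uu sg) tD tZ t1.
  - move=> j _; rewrite -{1}(tv j) -tM (sg_uv charF2 sg) tD tM tv; c2 tt.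
  - exact: pg_vC pg.
  - by move=> i j _ _; rewrite /GRing.comm -!tM (sg_uC sg).
  by move=> i j _ ij; rewrite /GRing.comm -{1 2}(tv i) -!tM (sg_vuC sg ij).
have [g [g0 gv gu]] := intertwiner charF2 (sg_a0 sg) pg pg'.
have aniso x : x \in gen_cent v u [set: J] [set: J] -> x * x = 0 -> x = 0.
  move=> /(gen_cent_setT sg)[c ->] /eqP.
  rewrite -scalerAl mul1r scalerA !scaler_eq0 mulf_eq0 orbb oner_eq0 orbF.
  by move/eqP ->; rewrite scale0r.
have idb : bijective (idfun : {lrmorphism A -> A}) by exists idfun.
have [h [hg gh]] := intertwiner_unit charF2 sg aniso idb g0 gv gu.
exists g, h; split=> //.
  apply/gen_centP; split=> j; first by rewrite /GRing.comm gv.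
  by rewrite in_setC => jI; rewrite /GRing.comm -gu ?in_setT //= tu.
apply: (gen_ind charF2 sg).
- by move=> c; rewrite tZ sZ t1 s1 -scalerAl -scalerAr mul1r mulr1.
- move=> x y j hx hy; rewrite tD sD mulrDl mulrDr hx; congr (_ + _).
  by rewrite tM sM tv (sg_sv sg) -mulrA hy mulrA gv mulrA.
move=> x y j hx hy; rewrite tD sD mulrDl mulrDr hx; congr (_ + _).
by rewrite tM sM (sg_su sg) -mulrA hy mulrA [t _ * g]gu ?in_setT // mulrA.
Qed.

(** The element [g] of [involutions_inner] is [c + z + s z] with [c != 0]. Once it is scaled to [G]
    with constant term [1], any [X] with [s X * (G * X) = 1] makes conjugation by [G * X] the
    required isomorphism. *)
Lemma same_generators_isomorphic : exists2 f : {lrmorphism A -> A},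
  bijective f & forall x, f (s x) = t (f x).
Proof.
have [g [h [gh hg gK gt]]] := involutions_inner.
have gP := gen_cent_Phi gK; have sg_g := Phi_sym charF2 orthS sg gP.
have kC : k \in ~: I by rewrite in_setC.
have [c [z [gE zv zu]]] := gen_cent_trace_form charF2 orthS sg kC gK.
have tE x : t x = g * s x * h by rewrite -gt -mulrA gh mulr1.
have sh : s h = h.
  by rewrite -[s h]mulr1 -gh mulrA -{1}sg_g -sM gh s1 mul1r.
(* If [c = 0], then [1 = g * h] equals [z * h + t (z * h)], which is alternating for [t]. *)
have c0 : c != 0.
  apply: contraT => /negbNE/eqP c0; case: orthT => _ _ [].
  apply/(AltP t charF2); exists (z * h); rewrite tE sM sh.
  rewrite !mulrA gh mul1r -mulrDl -[z + _]add0r addrA.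
  by rewrite -(scale0r (1 : A)) -c0 -gE gh.
pose G := c^-1 *: g; pose H := c *: h; pose Z := c^-1 *: z.
have GH : G * H = 1 by rewrite /G /H -scalerAl -scalerAr scalerA mulVf // scale1r.
have HG : H * G = 1 by rewrite /G /H -scalerAl -scalerAr scalerA mulfV // scale1r.
have GE : G = 1 + Z + s Z.
  by rewrite /G gE /Z sZ !scalerDr scalerA mulVf // scale1r.
have sG : s G = G by rewrite /G sZ sg_g.
have sH : s H = H by rewrite /H sZ sh.
have tG x : t x = G * s x * H.
  by rewrite /G /H -!scalerAl -!scalerAr scalerA mulVf // scale1r.
have [gv gu] := gen_centP _ _ _ _ _ gK.
have Gv : GRing.comm G (v k) by apply/commr_sym/commrZ/commr_sym/gv; rewrite in_setT.
have Gu : GRing.comm G (u k) by apply/commr_sym/commrZ/commr_sym/gu.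
have Zv : GRing.comm Z (v k) by apply/commr_sym/commrZ/commr_sym.
have Zu : GRing.comm Z (u k) by apply/commr_sym/commrZ/commr_sym.
clearbody G H Z.
have inv_comm x : GRing.comm G x -> GRing.comm H x.
  move=> Gx; rewrite /GRing.comm -[H * x]mulr1 -GH.
  by rewrite -mulrA [x * _]mulrA -Gx !mulrA HG mul1r.
have Hv := inv_comm _ Gv; have Hu := inv_comm _ Gu.
have sZv : GRing.comm (s Z) (v k).
  by rewrite /GRing.comm -{1 2}(sg_sv sg k) -!sM Zv.
have sZu : GRing.comm (s Z) (u k).
  by rewrite /GRing.comm -{1 2}(sg_su sg k) -!sM Zu.
have vv : v k * v k = 1 by rewrite (sg_vv sg) a1 ?scale1r.
have uu := sg_uu sg k; have uv := sg_uv charF2 sg k.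
(* In the basis [e1 + e2, e2] of the hermitian form [<G, G>] over the centralizer
   of [u k] and [v k], the Gram matrix is [[0, G], [G, G]]; [X] is the isometry
   from [<1, 1>] that rescales the first vector by [H] and uses [G = 1 + Z + s Z]
   to change the norm of the second from [G] to [1]. *)
have [N NE] : exists N, N = 1 + v k by exists (1 + v k).
pose X := u k * N + H * N * (1 + u k) + H * Z * N.
pose Y := N * u k + (1 + u k) * N * H + N * s Z * H.
have sN : s N = N by rewrite NE sD s1 (sg_sv sg).
have sX : s X = Y.
  by rewrite /X /Y !sD !sM !sD s1 (sg_su sg) sN sH !mulrA.
have YX : Y * (G * X) = 1.
  transitivity (G * N + Z * N + s Z * N + v k).
    rewrite /X /Y NE.
    by c2 (tt, vv, uu, uv, Gv, Gu, Hv, Hu, Zv, Zu, sZv, sZu, GH, HG).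
  by rewrite GE NE; c2 (tt, Zv, sZv).
have XY := left_inverse_unit YX.
have idb : bijective (idfun : {lrmorphism A -> A}) by exists idfun.
have [f fb fE] := conjugate_morphism idb XY YX.
exists f => // x; rewrite !fE tG !sM sG sX -sX sK sX.
by rewrite !mulrA -[_ * G * H]mulrA GH mulr1.
Qed.

End Core.

(** * Comparison through the alternator form *)

Lemma cards_injection (T T' : finType) (X : {set T}) (Y : {set T'}) :
  (0 < #|X|)%N -> (#|X| <= #|Y|)%N ->
  exists p : T -> T', {in X &, injective p} /\ forall x, x \in X -> p x \in Y.
Proof.
move=> X0 XY; have [y0 _] : exists y, y \in Y.
  by apply/card_gt0P; exact: leq_trans XY.
have bound x : x \in X -> (index x (enum X) < size (enum Y))%N.
  by move=> xX; rewrite -cardE (leq_trans _ XY) // cardE index_mem mem_enum.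
exists (fun x => nth y0 (enum Y) (index x (enum X))); split.
  move=> x1 x2 h1 h2 /eqP; rewrite nth_uniq ?enum_uniq ?bound // => /eqP h.
  by have := @index_inj _ x1 (enum X) x1 x2; rewrite !mem_enum; apply.
by move=> x hx; rewrite -mem_enum mem_nth // bound.
Qed.

Section Squares.

Variables (F : fieldType) (A : falgType F) (s : A -> A).
Hypothesis charF2 : 2%N \in [pchar F].
Variables (J : finType) (v u : J -> A) (a b : J -> F) (I : {set J}).
Hypothesis sg : symmetric_generators s v u a b.

Local Notation Phi := (gen_cent v u [set: J] set0).
Local Notation K := (gen_cent v u [set: J] (~: I)).

Ltac c2 hs := c2_with A charF2 hs.

(** Where [a j = 1], the square of [x0 + x1 * v j] is that of [x0 + x1], so [v j] can be replaced by
    [1]. *)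
Lemma Phi_square_in_K x : (forall j, j \notin I -> a j = 1) ->
  x \in Phi -> exists2 y, y \in K & y * y = x * x.
Proof.
move=> a1.
suff h (S : {set J}) y : y \in gen_cent v u [set: J] (~: I :&: S) ->
    exists2 z, z \in K & z * z = y * y.
  by move=> hx; apply: (h set0); rewrite setI0.
elim/setC_ind: S y => [|S j jS IH] y; first by rewrite setIT => hy; exists y.
have [jI|jI] := boolP (j \in ~: I); last first.
  suff -> : ~: I :&: S = ~: I :&: (j |: S) by exact: IH.
  apply/setP => k; rewrite !in_setI in_setU1; case: eqP => //= ->.
  by rewrite (negbTE jI).
have jIS : j \notin ~: I :&: S by rewrite in_setI negb_and jS orbT.
have IS : j |: (~: I :&: S) = ~: I :&: (j |: S).
  by apply/setP => k; rewrite !(in_setI, in_setU1); case: eqP => //= ->; rewrite jI.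
case/(gen_cent_decomp_u charF2 sg jIS) => x0 [x1 []]; rewrite IS => h0 h1 -> _.
have [z zK zz] := IH _ (memvD h0 h1); exists z => //; rewrite zz.
have h0P := gen_cent_Phi h0; have h1P := gen_cent_Phi h1.
have vv : v j * v j = 1 by rewrite (sg_vv sg) a1 ?scale1r // -in_setC.
by c2 (tt, vv, esym (Phi_comm_v j h0P), esym (Phi_comm_v j h1P),
  Phi_comm charF2 sg h1P h0P).
Qed.

Lemma Phi_square_sum (T : finType) (z : T -> A) :
  (forall i, z i \in Phi) -> (\sum_i z i) * (\sum_i z i) = \sum_i z i * z i.
Proof.
move=> hz; suff [] : \sum_i z i \in Phi /\
  (\sum_i z i) * (\sum_i z i) = \sum_i z i * z i by [].
apply: (big_rec2 (fun x y => x \in Phi /\ x * x = y)) => [|i x y _ [hy <-]].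
  by rewrite mem0v mul0r.
split; first by rewrite memvD.
by c2 (tt, Phi_comm charF2 sg (hz i) hy).
Qed.

End Squares.

Section CompareSquares.

Variables (F : fieldType) (A A' : falgType F) (s : A -> A) (s' : A' -> A').
Hypothesis charF2 : 2%N \in [pchar F].
Variables (J J' : finType) (v u : J -> A) (a b : J -> F) (I : {set J}).
Variables (v' u' : J' -> A') (a' b' : J' -> F) (I' : {set J'}).
Hypothesis sg : symmetric_generators s v u a b.
Hypothesis sg' : symmetric_generators s' v' u' a' b'.
Hypothesis aniso : forall x, x \in gen_cent v u [set: J] (~: I) -> x * x = 0 -> x = 0.
Hypothesis transfer : forall x c, x \in gen_cent v u [set: J] (~: I) -> x * x = c%:A ->
  exists2 x', x' \in gen_cent v' u' [set: J'] (~: I') & x' * x' = c%:A.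

(* Squaring is additive and injective on the anisotropic part, so a basis is sent
   to a free family by any choice of elements with the same squares. *)
Lemma card_anisotropic_le : (#|I| <= #|I'|)%N.
Proof.
suff : (#|~: ~: I| <= #|~: ~: I'|)%N by rewrite !setCK.
rewrite -(@leq_exp2l 2) // -(dim_gen_cent charF2 sg) -(dim_gen_cent charF2 sg').
set K := gen_cent v u _ _; set K' := gen_cent v' u' _ _.
pose X := vbasis K.
have XK i : X`_i \in K.
  have [hi|hi] := ltnP i (size X); last by rewrite nth_default // mem0v.
  by apply: vbasis_mem; rewrite mem_nth.
have [i|c hc] := @choice _ _ (fun i c => X`_i * X`_i = c%:A).
  exact: (Phi_sq charF2 sg (gen_cent_Phi (XK i))).
have [i|y hy] := @choice _ _ (fun i y => y \in K' /\ y * y = (c i)%:A).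
  by have [y h1 h2] := transfer (XK i) (hc i); exists y.
pose Y := [tuple y i | i < \dim K].
have yK i : y i \in K' by case: (hy i).
have sY : (<<Y>> <= K')%VS.
  by apply/span_subvP => _ /mapP[i _ ->].
apply: leq_trans (dimvS sY); have -> : \dim <<Y>> = \dim K; last by [].
suff /eqP -> : free Y by rewrite size_tuple.
apply/freeP => k hk.
have hk' : \sum_(i < \dim K) (k i *: y i) = 0.
  by rewrite -[RHS]hk; apply: eq_bigr => i _; rewrite -tnth_nth tnth_mktuple.
have yP i : k i *: y i \in gen_cent v' u' [set: J'] set0.
  by apply/memvZ/gen_cent_Phi/yK.
have XP (i : 'I_(\dim K)) : k i *: X`_i \in gen_cent v u [set: J] set0.
  by apply/memvZ/gen_cent_Phi/XK.
have kc : \sum_(i < \dim K) k i * k i * c i = 0.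
  have := Phi_square_sum charF2 sg' yP; rewrite hk' mul0r.
  under eq_bigr => i _ do
    rewrite -scalerAl -scalerAr (hy i).2 !scalerA.
  rewrite -scaler_suml => /esym/eqP; rewrite scaler_eq0 oner_eq0 orbF.
  by move/eqP.
have kX : \sum_(i < \dim K) k i *: X`_i = 0.
  apply: aniso; first by apply: memv_suml => i _; apply/memvZ/XK.
  rewrite (Phi_square_sum charF2 sg XP).
  under eq_bigr => i _ do rewrite -scalerAl -scalerAr hc !scalerA.
  by rewrite -scaler_suml kc scale0r.
by move/freeP: (basis_free (vbasisP K)); apply.
Qed.

End CompareSquares.

Section Transfer.

Variables (F : fieldType) (A A' : falgType F) (s : A -> A) (s' : A' -> A').
Hypothesis charF2 : 2%N \in [pchar F].
Hypothesis orthA : orthogonal_involution s.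
Hypothesis orthA' : orthogonal_involution s'.
Variables (J J' : finType) (v u : J -> A) (a b : J -> F) (I : {set J}).
Variables (v' u' : J' -> A') (a' b' : J' -> F) (I' : {set J'}).
Hypothesis sg : symmetric_generators s v u a b.
Hypothesis sg' : symmetric_generators s' v' u' a' b'.
Hypothesis a1 : forall k, k \notin I -> a k = 1.
Hypothesis b0 : forall k, k \notin I -> b k = 0.
Hypothesis a'1 : forall k, k \notin I' -> a' k = 1.
Hypothesis b'0 : forall k, k \notin I' -> b' k = 0.
Hypothesis aniso : forall x, x \in gen_cent v u [set: J] (~: I) -> x * x = 0 -> x = 0.
Hypothesis transfer : forall x c, x \in gen_cent v u [set: J] set0 -> x * x = c%:A ->
  exists2 x', x' \in gen_cent v' u' [set: J'] (~: I') & x' * x' = c%:A.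
Variable p : J -> J'.
Hypothesis p_inj : {in ~: I &, injective p}.
Hypothesis pI : forall k, k \in ~: I -> p k \in ~: I'.
Variable k0 : J.
Hypothesis k0I : k0 \notin I.

(** For [j] in [I], [w j] is a square root of [a j] in K', so it commutes with every [u' (p k)];
    outside [I] the pairs are matched by [p]. An intertwiner turns [f] into an isomorphism [g] with
    these values on generators, and [same_generators_isomorphic] compares [s] with the pullback of
    [s'] along [g]. *)
Lemma transport_isomorphic (f : {lrmorphism A -> A'}) :
  bijective f -> inv_isomorphic s s'.
Proof.
move=> f_bij.
have vC j : v j \in gen_cent v u [set: J] set0.
  by apply/gen_centP; split=> k; [move=> _; exact: sg_vC sg _ _|rewrite inE].
have v'C j : v' j \in gen_cent v' u' [set: J'] set0.
  by apply/gen_centP; split=> k; [move=> _; exact: sg_vC sg' _ _|rewrite inE].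
have [j|w hw] := @choice _ _ (fun j (w : A') => w * w = (a j)%:A /\
    if j \in I then is_true (w \in gen_cent v' u' [set: J'] (~: I'))
    else w = v' (p j)).
  have [jI|jI] := boolP (j \in I).
    by have [w h1 h2] := transfer (vC j) (sg_vv sg j); exists w.
  exists (v' (p j)); split=> //; rewrite (sg_vv sg') a1 // a'1 //.
  by rewrite -in_setC pI // in_setC.
have wP j : w j \in gen_cent v' u' [set: J'] set0.
  have [_] := hw j; case: ifP => _ h; first exact: gen_cent_Phi h.
  by rewrite h; exact: v'C.
have wE k : k \in ~: I -> w k = v' (p k).
  by rewrite in_setC => /negbTE kI; have [_] := hw k; rewrite kI.
have pI' k : k \in ~: I -> p k \notin I' by move=> kI; rewrite -in_setC pI.
have pg' : partial_generators (~: I) w (u' \o p) a b.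
  split=> /=.
  - by move=> j; case: (hw j).
  - move=> k kI; rewrite (sg_uu sg') b'0 ?pI' // b0 //.
    by move: kI; rewrite in_setC.
  - by move=> k kI; rewrite wE // (sg_vu sg').
  - by move=> i j; exact: (Phi_comm charF2 sg').
  - by move=> i j _ _; exact: sg_uC sg' _ _.
  move=> i k kI ik; have [iI|iI] := boolP (i \in ~: I); last first.
    have [_] := hw i; rewrite in_setC negbK in iI; rewrite iI.
    by case/gen_centP=> _; apply; exact: pI.
  rewrite wE //; apply: (sg_vuC sg'); apply: contraNneq ik => h.
  by apply/eqP/p_inj.
have pg := partial_generators_morph f (generators_partial (~: I) sg).
have [y [y0 yv yu]] := intertwiner charF2 (sg_a0 sg) pg pg'.
have [z [zy yz]] := intertwiner_unit charF2 sg aniso f_bij y0 yv yu.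
have [g gb gE] := conjugate_morphism f_bij yz zy.
have gv j : g (v j) = w j by rewrite gE -yv -mulrA yz mulr1.
have gu k : k \in ~: I -> g (u k) = u' (p k).
  by move=> kI; rewrite gE -yu // -mulrA yz mulr1.
have [h gK hK] := gb.
have [[sD sM sK] s1 nalt] := orthA'.
pose t x := h (s' (g x)).
have gt x : g (t x) = s' (g x) by rewrite /t hK.
have g_inj : injective g := can_inj gK.
have orthT : orthogonal_involution t.
  split; first split.
  - by move=> x1 x2; apply: g_inj; rewrite gt rmorphD [RHS]rmorphD /= !gt sD.
  - by move=> x1 x2; apply: g_inj; rewrite gt rmorphM [RHS]rmorphM /= !gt sM.
  - by move=> x; apply: g_inj; rewrite !gt sK.
  - by move=> c; apply: g_inj; rewrite gt rmorph_alg s1.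
  case=> x _ hx; apply: nalt; exists (g x) => //.
  by rewrite -gt -rmorphB hx rmorph1.
have tv j : t (v j) = v j.
  by apply: g_inj; rewrite gt gv (Phi_sym charF2 orthA' sg' (wP j)).
have tu k : k \notin I -> t (u k) = u k.
  rewrite -in_setC => kI; apply: g_inj.
  by rewrite gt gu // (sg_su sg').
have [e eb eE] := same_generators_isomorphic charF2 orthA orthT sg a1 tv tu k0I.
exists (g \o e); split; first exact: bij_comp.
by move=> x /=; rewrite eE gt.
Qed.

End Transfer.

(** * Both implications of the classification *)

Lemma isomorphic_alternator_form (F : fieldType) (A A' : falgType F)
    (s : A -> A) (s' : A' -> A') (f : {lrmorphism A -> A'}) :
  bijective f -> (forall x, f (s x) = s' (f x)) ->
  isometric (alternator_subalgebra s) (alternator_form s)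
            (alternator_subalgebra s') (alternator_form s').
Proof.
move=> [g fK gK] fs; have f_inj := can_inj fK.
have altE x : Alt s' (f x) <-> Alt s x.
  split=> [[y _]|[y _ <-]]; last by exists (f y) => //; rewrite -fs -rmorphB.
  rewrite -[y]gK -fs -rmorphB => /f_inj h; by exists (g y).
have SE x : alternator_subalgebra s' (f x) <-> alternator_subalgebra s x.
  split=> [[c [w [hw hx]]]|[c [w [hw hx]]]].
    exists c, (g w); split; first by apply/altE; rewrite gK.
    apply: f_inj; rewrite rmorphM /= fs hx rmorphD /= gK; congr (_ + _).
    by rewrite rmorph_alg.
  exists c, (f w); split; first exact/altE.
  by rewrite -fs -rmorphM hx rmorphD /= rmorph_alg.
exists f; split.
- split=> [x /SE //|x y _ _ /f_inj //|y hy].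
  exists (g y); last exact: gK.
  by apply/SE; rewrite gK.
- by move=> c x y _ _; rewrite linearP.
move=> x _; rewrite /alternator_form; congr xget.
apply/seteqP; split=> c /=; rewrite -fs -rmorphM -(rmorph_alg f) -rmorphD.
  by move/altE.
by move=> h; apply/altE.
Qed.

(** If [I] were all of [J], then Phi would be K, hence anisotropic; but an isotropic vector of [s]
    has alternator value [0] and yields a nonzero square-zero element of Phi. *)
Lemma isotropic_proper (F : fieldType) (A : falgType F) (s : A -> A)
    (J : finType) (v u : J -> A) (a b : J -> F) (I : {set J}) :
  2%N \in [pchar F] -> orthogonal_involution s ->
  symmetric_generators s v u a b ->
  (forall x, x \in gen_cent v u [set: J] (~: I) -> x * x = 0 -> x = 0) ->
  isotropic s -> exists k, k \notin I.
Proof.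
move=> charF2 orthA sg aniso [x x0 sx].
have s0 : s 0 = 0.
  by case: orthA => h1 h2 _; have := involutionZ h1 h2 0 0; rewrite !scale0r.
have alt0 : Alt s (s x * x) by exists 0 => //; rewrite s0 subr0 sx.
have [y [yP y0 yy]] := alternator_isotropic charF2 orthA sg x0 alt0.
apply/existsP; apply: contraT => /existsPn h.
case/negP: y0; apply/eqP/aniso => //; suff -> : ~: I = set0 by [].
by apply/setP => k; rewrite !inE; exact/negbTE/h.
Qed.

(** The scalar [c] is the alternator value of [x], hence of [g x], hence the square of an element of
    Phi', which [Phi_square_in_K] moves into K'. *)
Lemma alternator_transfer (F : fieldType) (A A' : falgType F)
    (s : A -> A) (s' : A' -> A') (J J' : finType)
    (v u : J -> A) (a b : J -> F) (v' u' : J' -> A') (a' b' : J' -> F)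
    (I' : {set J'}) (g : A -> A') x c :
  2%N \in [pchar F] -> orthogonal_involution s -> orthogonal_involution s' ->
  symmetric_generators s v u a b -> symmetric_generators s' v' u' a' b' ->
  (forall k, k \notin I' -> a' k = 1) ->
  (forall x, alternator_subalgebra s x -> alternator_subalgebra s' (g x) /\
     alternator_form s' (g x) = alternator_form s x) ->
  x \in gen_cent v u [set: J] set0 -> x * x = c%:A ->
  exists2 x', x' \in gen_cent v' u' [set: J'] (~: I') & x' * x' = c%:A.
Proof.
move=> charF2 orthA orthA' sg sg' a'1 hg xP xx.
have [xS xc] := Phi_alternator charF2 orthA sg xP xx.
have [gS gc] := hg x xS.
have [y yP yy] := alternator_form_value charF2 orthA' sg' gS.
have [z zK zz] := Phi_square_in_K charF2 sg' a'1 yP.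
by exists z => //; rewrite zz yy gc xc.
Qed.

Lemma alg_isomorphic_dim (F : fieldType) (A A' : falgType F)
    (f : {lrmorphism A -> A'}) : bijective f -> \dim {:A} = \dim {:A'}.
Proof.
move=> fb; rewrite -(limg_dim_eq (f := linfun f)).
  congr (\dim _); apply/eqP; rewrite eqEsubv subvf; apply/subvP => y _.
  have [g fK gK] := fb; rewrite -[y]gK -[f (g y)](lfunE f).
  by rewrite memv_img ?memvf.
apply/eqP; rewrite -subv0; apply/subvP => x.
rewrite memv_cap memv_ker lfunE memv0 => /andP[_ /eqP h].
by apply/eqP/(bij_inj fb); rewrite h rmorph0.
Qed.


Unset Implicit Arguments.

Theorem theorem4p6 (F : fieldType) (charF2 : 2%N \in [pchar F])
  (A A' : falgType F) (s : A -> A) (s' : A' -> A')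
  (csA : central_simple A) (csA' : central_simple A')
  (orthA : orthogonal_involution s) (orthA' : orthogonal_involution s')
  (tdA : totally_decomposable s) (tdA' : totally_decomposable s')
  (isoA : isotropic s) (isoA' : isotropic s') :
  inv_isomorphic s s' <->
  (alg_isomorphic A A' /\
   isometric (alternator_subalgebra s) (alternator_form s)
             (alternator_subalgebra s') (alternator_form s')).
Proof.
split=> [[f [fb fs]]|[[f fb] [g [g_bij _ gq]]]].
  by split; [exists f|exact: isomorphic_alternator_form fs].
have [n [v0 [u0 [a0 [b0 sg0]]]]] := decomposable_generators charF2 csA orthA tdA.
have [n' [v0' [u0' [a0' [b0' sg0']]]]] :=
  decomposable_generators charF2 csA' orthA' tdA'.
have [I [v [u [a [b [sg a1 bI aniso]]]]]] := normal_generators charF2 orthA sg0.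
have [I' [v' [u' [a' [b' [sg' a'1 b'I aniso']]]]]] :=
  normal_generators charF2 orthA' sg0'.
have [k kI] := isotropic_proper charF2 orthA sg aniso isoA.
have [g_fun g_inj g_surj] := g_bij.
have hg x : alternator_subalgebra s x -> alternator_subalgebra s' (g x) /\
    alternator_form s' (g x) = alternator_form s x.
  by move=> hx; split; [exact: g_fun|exact: gq].
(* [h] inverts [g] on the alternator subalgebra of [s'], so the transfer also works backwards. *)
have [x'|h hh] := @choice _ _ (fun x' x => alternator_subalgebra s' x' ->
    alternator_subalgebra s x /\ alternator_form s x = alternator_form s' x').
  have [hx'|hx'] := EM (alternator_subalgebra s' x'); last by exists 0.
  by have [x hx <-] := g_surj x' hx'; exists x => _; rewrite gq.
have tr x c := @alternator_transfer _ _ _ _ _ _ _ v u a b v' u' a' b' I' g x c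
  charF2 orthA orthA' sg sg' a'1 hg.
have tr' x c := @alternator_transfer _ _ _ _ _ _ _ v' u' a' b' v u a b I h x c
  charF2 orthA' orthA sg' sg a1 hh.
(* [tr] and [tr'] realize the squares of K in K' and conversely, which gives both inequalities. *)
have II' : #|I| = #|I'|.
  apply/eqP; rewrite eqn_leq; apply/andP; split.
    apply: (card_anisotropic_le charF2 sg sg' aniso) => x c hx.
    by apply: tr; exact: gen_cent_Phi hx.
  apply: (card_anisotropic_le charF2 sg' sg aniso') => x c hx.
  by apply: tr'; exact: gen_cent_Phi hx.
(* The dimension determines the number of factors, so the complements of [I] and [I'] have the same
   size and [p] can match their split pairs. *)
have JJ' : #|'I_n| = #|'I_n'|.
  apply/eqP; rewrite -(eqn_exp2l (m := 4)) //; apply/eqP.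
  rewrite -(dim_generated charF2 sg) -(dim_generated charF2 sg').
  exact: alg_isomorphic_dim fb.
have [||p [p_inj pI]] := @cards_injection _ _ (~: I) (~: I').
- by apply/card_gt0P; exists k; rewrite in_setC.
- by rewrite -(leq_add2l #|I|) cardsC II' cardsC JJ'.
exact: (transport_isomorphic charF2 orthA orthA' sg sg' a1 bI a'1 b'I aniso tr
  p_inj pI kI fb).
Qed.
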